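(* Given a symmetric fair division instance with $n$ agents having $\mathsf{SPLC}$ valuations, Algorithm E (described in the context) gives each agent $i\in[n]$ a bundle $A_i$ such that $v_i(A_i)\ge\frac12\mathsf{MMS}_i$.
   Context: Setting. There are $n$ agents, $\mathcal N=[n]$, with equal entitlements. $\mathsf{SPLC}$ (separable piecewise-linear concave) valuations: there are $t$ types of goods, type $j\in[t]$ having $k_j$ identical copies; $\mathcal M$ is the set of all copies of all goods and $\mathcal M_j\subseteq\mathcal M$ is the set of copies of good $j$. Agent $i$ has values $v_{ij1}\ge v_{ij2}\ge\dots\ge v_{ijk_j}\ge 0$ for each $j\in[t]$, and $v_i(S)=\sum_{j\in[t]}\sum_{k\le |S\cap\mathcal M_j|}v_{ijk}$ for $S\subseteq\mathcal M$. The maximin share of agent $i$ is $\mathsf{MMS}_i=\max\min_{k\in[n]}v_i(B_k)$, the maximum over all partitions $(B_1,\dots,B_n)$ of $\mathcal M$ (empty parts allowed). Algorithm E (it assumes the values $\mathsf{MMS}_i$ are available, so it is not claimed to run in polynomial time). (1) Set $\mu_i=\mathsf{MMS}_i$ for all $i$. Start with all agents active and all copies of all goods active. (2) While there are an active agent $i$ and a good $j$ with an active copy such that $v_{ij1}\ge\mu_i/2$: give $i$ one copy of $j$ as her bundle $A_i$, make $i$ inactive, and remove that copy of $j$. (3) On the remaining instance (active agents, remaining numbers $k_j$ of copies), find an optimal solution $x^*$ of the linear program: maximize $\sum_{i,j,k}v_{ijk}x_{ijk}$ subject to $\sum_{j,k}v_{ijk}x_{ijk}\ge\mu_i$ for every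 active agent $i$, $\sum_{i,k}x_{ijk}\le k_j$ for every good $j$, and $0\le x_{ijk}\le1$ for all $i,j,k$. (4) Round $x^*$ to an integral allocation to the active agents, as follows. Modify $x^*$ so that for each agent $i$ and good $j$ at most one $x_{ijk}$ is fractional (move mass to lower-index copies). The fractional allocation graph is the bipartite graph between agents and goods with an edge $ij$ whenever agent $i$ receives a copy of good $j$ fractionally. Convert $x^*$ into a fractional solution $\bar x$ whose fractional allocation graph has no cycles and for which every agent $i$ has the same value $\sum_{j,k}v_{ijk}\bar x_{ijk}=\sum_{j,k}v_{ijk}x^*_{ijk}$; this is done by cancelling cycles: with edge weights $w_{ij}=x_{ij}p_j$, where $x_{ij}$ is the fractional amount of good $j$ given to $i$ and $p_j$ is the optimal dual variable of the supply constraint of good $j$, alternately subtract and add the minimum edge weight around the cycle. In the resulting forest, root every tree at an arbitrary agent, and assign to each agent a copy of each of her child goods, in addition to the copies she receives integrally. (5) Return $(A_i)_{i\in\mathcal N}$.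
   Formalization: Cycle cancelling: where adding the minimum edge weight would push some x_ijk above 1 (so x̄ would not be a solution), the amount is capped so that this x_ijk becomes 1; where p_j = 0 (dividing by p_j is undefined) the cycle's edges at j are removed; the minimum edge is a subtracted one. *)

(* Defs.v *)
From HB Require Import structures.
From mathcomp Require Import all_boot all_order all_algebra.

Set Implicit Arguments.
Unset Strict Implicit.
Unset Printing Implicit Defensive.

Import Order.TTheory GRing.Theory Num.Theory.
Local Open Scope ring_scope.

(* Total correctness of a nondeterministic program: whatever choices are made,
   execution from s never gets stuck, never runs forever, and reaches Q. *)
Inductive always_reaches (S : Type) (step : S -> S -> Prop) (Q : S -> Prop) :
    S -> Prop :=
| Reached s of Q s : always_reaches step Q s
| Progress s of (exists s', step s s')
    & (forall s', step s s' -> always_reaches step Q s') :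
    always_reaches step Q s.

Section Instance.

Variables (R : realFieldType) (n t : nat) (K : 'I_t -> nat).

(* Good j has K j copies.  Ranks are counted from 0: v i j k is the value
   v_{i,j,k+1} of the text, and is meaningful for k < K j only. *)
Definition copy := {j : 'I_t & 'I_(K j)}.
Definition copies_of (j : 'I_t) : {set copy} := [set c | tag c == j].

Definition splc (v : 'I_n -> 'I_t -> nat -> R) : Prop :=
  (forall i j k, (k < K j)%N -> 0 <= v i j k) /\
  (forall i j k l, (k <= l)%N -> (l < K j)%N -> v i j l <= v i j k).

Variable v : 'I_n -> 'I_t -> nat -> R.

Definition value (i : 'I_n) (S : {set copy}) : R :=
  \sum_(j < t) \sum_(k < #|S :&: copies_of j|) v i j k.

(* B : {ffun copy -> 'I_n} is the partition whose k-th part is B @^-1: [set k].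
   Values lie between 0 and the value of all copies, so for n > 0 the
   defaults 0 and value i setT do not affect the maximum and the minimum. *)
Definition mms (i : 'I_n) : R :=
  \big[Num.max/0]_(B : {ffun copy -> 'I_n})
    \big[Num.min/value i setT]_(k < n) value i (B @^-1: [set k]).

Variable mu : 'I_n -> R.

(** Linear program for the active agents N and the active copies C *)

Implicit Types (N : {set 'I_n}) (C : {set copy}) (p : 'I_t -> R).
Implicit Types (A : {ffun 'I_n -> {set copy}}).
Implicit Types (x y : 'I_n -> 'I_t -> nat -> R).

Definition supply C j : nat := #|C :&: copies_of j|.

(* The program has a variable x i j k only for i \in N and k < supply C j;
   the other entries are set to 0. *)
Definition bounded N C x : Prop :=
  forall i j k, if (i \in N) && (k < supply C j)%N then 0 <= x i j k <= 1
                else x i j k == 0.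

Definition lp_value C x i : R :=
  \sum_(j < t) \sum_(k < supply C j) v i j k * x i j k.

Definition lp_feasible N C x : Prop :=
  [/\ bounded N C x,
      forall i, i \in N -> mu i <= lp_value C x i
    & forall j, \sum_(i in N) \sum_(k < supply C j) x i j k <= (supply C j)%:R].

Definition lp_optimal N C x : Prop :=
  lp_feasible N C x /\
  forall y, lp_feasible N C y ->
    \sum_(i in N) lp_value C y i <= \sum_(i in N) lp_value C x i.

(* Dual variables: alpha i for the value constraint of agent i, p j for the
   supply constraint of good j, q i j k for x i j k <= 1. *)
Definition dual_feasible N C (alpha : 'I_n -> R) p
    (q : 'I_n -> 'I_t -> nat -> R) : Prop :=
  [/\ forall i, i \in N -> 0 <= alpha i,
      forall j, 0 <= p j,
      forall i j k, i \in N -> (k < supply C j)%N -> 0 <= q i j k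
    & forall i j k, i \in N -> (k < supply C j)%N ->
        v i j k + alpha i * v i j k <= p j + q i j k].

Definition dual_objective N C (alpha : 'I_n -> R) p
    (q : 'I_n -> 'I_t -> nat -> R) : R :=
  \sum_(j < t) (supply C j)%:R * p j
  + \sum_(i in N) \sum_(j < t) \sum_(k < supply C j) q i j k
  - \sum_(i in N) alpha i * mu i.

Definition optimal_supply_dual N C p : Prop :=
  exists alpha q, dual_feasible N C alpha p q /\
    forall alpha' p' q', dual_feasible N C alpha' p' q' ->
      dual_objective N C alpha p q <= dual_objective N C alpha' p' q'.

(** Fractional allocation graph *)

Definition fractional (a : R) : bool := 0 < a < 1.

Definition frac_edge x (i : 'I_n) (j : 'I_t) : bool :=
  [exists k : 'I_(K j), fractional (x i j k)].

Definition mass_moved_down N C x y : Prop :=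
  [/\ bounded N C y,
      forall i j, \sum_(k < supply C j) y i j k = \sum_(k < supply C j) x i j k,
      forall i j l, (l <= supply C j)%N ->
        \sum_(k < l) x i j k <= \sum_(k < l) y i j k
    & forall i j k l, fractional (y i j k) -> fractional (y i j l) -> k = l].

(* The cycle i_0 - j_0 - i_1 - j_1 - ... - j_{m-1} - i_0 (m >= 2) is represented
   by s = [:: (i_0, j_0); ...; (i_{m-1}, j_{m-1})].  Its edges are alternately
   the (i_a, j_a), listed by s, and the (i_{a+1}, j_a), listed by alternate s. *)
Definition alternate (s : seq ('I_n * 'I_t)) : seq ('I_n * 'I_t) :=
  zip (rot 1 (unzip1 s)) (unzip2 s).

Definition frac_cycle x (s : seq ('I_n * 'I_t)) : bool :=
  [&& (1 < size s)%N, uniq (unzip1 s), uniq (unzip2 s)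
    & all (fun e => frac_edge x e.1 e.2) (s ++ alternate s)].

(* At most one term of the sum is present once mass has been moved down. *)
Definition frac_amount x (i : 'I_n) (j : 'I_t) : R :=
  \sum_(k < K j | fractional (x i j k)) x i j k.

Definition weight x p (e : 'I_n * 'I_t) : R := frac_amount x e.1 e.2 * p e.2.

(* Along the cycle s the weight delta is subtracted on the edges in s and added
   on those in alternate s; amounts are then recovered from weights by dividing
   by p j.  An edge at a good of price 0 has weight 0 (hence delta = 0), and as
   _ / 0 = 0 its amount becomes 0: it is removed, which costs the agent nothing
   since by complementary slackness she has value 0 for that fraction. *)
Definition cancel x p (s : seq ('I_n * 'I_t)) (delta : R) :
    'I_n -> 'I_t -> nat -> R :=
  fun i j k =>
    if ~~ fractional (x i j k) then x i j k
    else if (i, j) \in s then (weight x p (i, j) - delta) / p j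
    else if (i, j) \in alternate s then (weight x p (i, j) + delta) / p j
    else x i j k.

Definition is_min (a : R) (r : seq R) : bool := (a \in r) && all (>= a) r.

(* delta0 is the minimum weight on the cycle, attained at a subtracted edge.
   It is used as such unless it would give more than one whole copy on an added
   edge (e of weight above p e.2), where x would no longer be a solution. *)
Definition cancel_amount x p (s : seq ('I_n * 'I_t)) (delta : R) : Prop :=
  exists delta0 : R,
    [/\ is_min delta0 [seq weight x p e | e <- s ++ alternate s],
        delta0 \in [seq weight x p e | e <- s]
      & is_min delta (delta0 :: [seq p e.2 - weight x p e | e <- alternate s])].

(** Rounding *)

Definition graph_rel x : rel ('I_n + 'I_t) := fun a b =>
  match a, b with
  | inl i, inr j | inr j, inl i => frac_edge x i j
  | _, _ => false
  end.

(* One root agent in every tree that contains an active agent; the other trees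
   are single vertices (goods without edges, inactive agents). *)
Definition rooting N x (roots : {set 'I_n}) : Prop :=
  roots \subset N /\
  forall i, i \in N ->
    #|[set r in roots | connect (graph_rel x) (inl r) (inl i)]| = 1%N.

(* In a rooted forest, the neighbours of i other than its parent are those that
   are not on the path from the root to i. *)
Definition child x (roots : {set 'I_n}) (i : 'I_n) (j : 'I_t) : bool :=
  frac_edge x i j &&
  [exists r in roots,
     connect [rel a b | [&& graph_rel x a b, a != inr j & b != inr j]]
             (inl r) (inl i)].

Definition integral_copies x (i : 'I_n) (j : 'I_t) : nat :=
  #|[set k : 'I_(K j) | x i j k == 1]|.

Definition rounded N C A x (roots : {set 'I_n}) A' : Prop :=
  [/\ forall i, i \notin N -> A' i = A i,
      forall i, i \in N -> A' i \subset C,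
      forall i i', i \in N -> i' \in N -> i != i' -> [disjoint A' i & A' i']
    & forall i j, i \in N ->
        #|A' i :&: copies_of j|
          = (integral_copies x i j + child x roots i j)%N].

(** The algorithm *)

Inductive state :=
| Reducing of {set 'I_n} & {set copy} & {ffun 'I_n -> {set copy}}
| Solved of {set 'I_n} & {set copy} & {ffun 'I_n -> {set copy}}
    & ('I_n -> 'I_t -> nat -> R) & ('I_t -> R)
| Cancelling of {set 'I_n} & {set copy} & {ffun 'I_n -> {set copy}}
    & ('I_n -> 'I_t -> nat -> R) & ('I_t -> R)
| Returned of {ffun 'I_n -> {set copy}}.

Definition initial : state := Reducing setT setT [ffun=> set0].

Definition reducible N C (i : 'I_n) (c : copy) : bool :=
  [&& i \in N, c \in C & mu i / 2 <= v i (tag c) 0%N].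

Inductive step : state -> state -> Prop :=
| Reduce N C A i c of reducible N C i c :
    step (Reducing N C A)
         (Reducing (N :\ i) (C :\ c)
                   [ffun i' => if i' == i then [set c] else A i'])
| Solve N C A x p of (forall i c, ~~ reducible N C i c)
    & lp_optimal N C x & optimal_supply_dual N C p :
    step (Reducing N C A) (Solved N C A x p)
| MoveDown N C A x y p of mass_moved_down N C x y :
    step (Solved N C A x p) (Cancelling N C A y p)
| Cancel N C A x p s delta of frac_cycle x s & cancel_amount x p s delta :
    step (Cancelling N C A x p) (Cancelling N C A (cancel x p s delta) p)
| Round N C A x p roots A' of (forall s, ~~ frac_cycle x s)
    & rooting N x roots & rounded N C A x roots A' :
    step (Cancelling N C A x p) (Returned A').

End Instance.

(* Main.v *)
Require Import Defs.
From mathcomp Require Import all_boot all_order all_algebra.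
From mathcomp Require Import ring lra.
Import Order.TTheory GRing.Theory Num.Theory.
Local Open Scope ring_scope.

(* Giving an agent a single good worth half her share removes one part from
   every other agent's maximin partition, so the remaining agents keep theirs;
   averaging the parts of these partitions shows that the linear program is
   feasible, and Fourier-Motzkin elimination yields optimal primal and dual
   solutions over any ordered field.  By complementary slackness all fractional
   goods of an agent have the same value per unit of price, which makes
   cancelling a cycle neutral for every agent on it, while some entry on the
   cycle becomes integral.  In the final forest every good has at most one
   parent, so the rounding fits in the supply, and every agent loses only the
   fractional copy of her own parent, worth less than half her share because no
   reduction applies. *)

Set Implicit Arguments.
Unset Strict Implicit.
Unset Printing Implicit Defensive.

(** * Linear programming duality *)

(** No compactness is available over an arbitrary ordered field, so the optima must come from a
    finite argument: a pair of primal and dual solutions without gap is extracted from Farkas's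
    lemma. The claim concerns every run, and a run may pick any primal optimum and, independently,
    any optimal prices. Complementary slackness is nevertheless available, because one pair without
    gap forces all optimal pairs to have none. Once cycles are cancelled, the argument no longer
    refers to optimality itself, but only to its trace on the fractional entries: each satisfies
    [(1 + alpha i) * v i j k = p j]. This survives every cancellation because no cancellation
    creates a fractional entry, and the number of fractional entries also serves as the termination
    measure. *)

Lemma exists_between (R : realFieldType) (I : finType) (L U : pred I)
    (f g : I -> R) :
  (forall i k, L i -> U k -> f i <= g k) ->
  exists z, (forall i, L i -> f i <= z) /\ (forall k, U k -> z <= g k).
Proof.
move=> fg; case: (pickP L) => [i0 Li0|L0].
  case: (arg_maxP f Li0) => i Li imax; exists (f i).
  by split=> [k /imax|k Uk] //; exact: fg.
case: (pickP U) => [k0 Uk0|U0].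
  case: (arg_minP g Uk0) => k Uk kmin; exists (g k).
  by split=> [i|i /kmin] //; rewrite L0.
by exists 0; split=> i; rewrite ?L0 ?U0.
Qed.

Section LinearInequalities.

Variable R : realFieldType.

(* Fourier-Motzkin elimination: every new row is a nonnegative combination of
   the old rows in which the coefficient of j0 vanishes. *)
Lemma fourier_motzkin (I J : finType) (a : I -> J -> R) (b : I -> R) (j0 : J) :
  exists (I' : finType) (c : I' -> I -> R),
    [/\ forall r i, 0 <= c r i,
        forall r, \sum_i c r i * a i j0 = 0
      & forall x : J -> R,
          (forall r, \sum_i c r i * (\sum_j a i j * x j) <= \sum_i c r i * b i) ->
          exists z, forall i,
            \sum_j a i j * (if j == j0 then z else x j) <= b i].
Proof.
(* Row [inl k] keeps a row without [j0]; row [inr (k, l)] combines an upper bound [k] on the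
   variable [j0] with a lower bound [l]. Indices of the wrong sign give the zero row, which is
   harmless and spares a subtype. *)
pose c (r : I + I * I) (i : I) : R := match r with
  | inl k => if (a k j0 == 0) && (i == k) then 1 else 0
  | inr (k, l) => if (0 < a k j0) && (a l j0 < 0) then
      (if i == k then - a l j0 else 0) + (if i == l then a k j0 else 0) else 0
  end.
have pick1 (F : I -> R) (k : I) (z : R) : \sum_i (if i == k then z else 0) * F i = z * F k.
  rewrite (bigD1 k) //= eqxx big1 ?addr0 // => i /negPf->; exact: mul0r.
have cl k (F : I -> R) : a k j0 == 0 -> \sum_i c (inl k) i * F i = F k.
  by move=> ak; rewrite /c ak pick1 mul1r.
have cr k l (F : I -> R) : 0 < a k j0 -> a l j0 < 0 ->
    \sum_i c (inr (k, l)) i * F i = - a l j0 * F k + a k j0 * F l.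
  move=> ak al; rewrite /c ak al /=.
  under eq_bigr do rewrite mulrDl.
  by rewrite big_split !pick1.
exists (I + I * I)%type, c; split.
- move=> [k|[k l]] i /=; first by case: ifP.
  case: ifP => // /andP[ak al].
  by rewrite addr_ge0 //; case: ifP => // _; lra.
- move=> [k|[k l]].
    case: (boolP (a k j0 == 0)) => [ak|/negPf ak].
      by rewrite cl //; exact/eqP.
    by rewrite /c ak /= big1 // => i _; rewrite mul0r.
  case: (boolP ((0 < a k j0) && (a l j0 < 0))) => [/andP[ak al]|/negPf ak].
    by rewrite cr //; ring.
  by rewrite /c ak /= big1 // => i _; rewrite mul0r.
move=> x Hx.
pose rest i := \sum_(j | j != j0) a i j * x j.
have splitx i z : \sum_j a i j * (if j == j0 then z else x j) = a i j0 * z + rest i.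
  rewrite (bigD1 j0) //= eqxx; congr (_ + _).
  by apply: eq_bigr => j /negPf->.
have fullx i : \sum_j a i j * x j = a i j0 * x j0 + rest i.
  by rewrite (bigD1 j0).
have [|z [zl zu]] := @exists_between R I (fun l => a l j0 < 0)
    (fun k => 0 < a k j0) (fun l => (b l - rest l) / a l j0)
    (fun k => (b k - rest k) / a k j0).
  move=> l k al ak; have := Hx (inr (k, l)); rewrite !cr // !fullx => H.
  rewrite ler_pdivlMr // mulrAC ler_ndivrMr //; nra.
exists z => i; rewrite splitx.
case: (ltgtP (a i j0) 0) => ai.
- by have := zl i ai; rewrite ler_ndivrMr //; lra.
- by have := zu i ai; rewrite ler_pdivlMr //; lra.
- by have := Hx (inl i); rewrite !cl ?ai // fullx ai; lra.
Qed.

(** Induction on a set [S] containing all variables that still occur; an eliminated variable stays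
    in [J] with zero coefficients, whereas the row type changes at each elimination and must be
    generalized. A certificate for the reduced system pulls back through the nonnegative
    coefficients [c]. Without variables the rows read [0 <= b i], and a violated one is its own
    certificate. *)
Lemma farkas (I J : finType) (a : I -> J -> R) (b : I -> R) :
  (exists x, forall i, \sum_j a i j * x j <= b i) \/
  (exists y, [/\ forall i, 0 <= y i, forall j, \sum_i y i * a i j = 0
               & \sum_i y i * b i < 0]).
Proof.
suff: forall (m : nat) (S : {set J}) (I : finType) (a : I -> J -> R) (b : I -> R),
    #|S| = m -> (forall i j, j \notin S -> a i j = 0) ->
    (exists x, forall i, \sum_j a i j * x j <= b i) \/
    (exists y, [/\ forall i, 0 <= y i, forall j, \sum_i y i * a i j = 0
                 & \sum_i y i * b i < 0]).
  by move=> /(_ _ setT I a b erefl); apply=> i j; rewrite inE.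
elim=> [|m IH] S {}I {}a {}b.
  move/eqP; rewrite cards_eq0 => /eqP-> a0.
  have a00 i j : a i j = 0 by rewrite a0 ?inE.
  case: (pickP (fun i => b i < 0)) => [i bi|b0].
    right; exists (fun k => if k == i then 1 else 0); split.
    - by move=> k; case: ifP.
    - by move=> j; rewrite big1 // => k _; rewrite a00 mulr0.
    - rewrite (bigD1 i) //= eqxx mul1r big1 ?addr0 // => k /negPf->.
      exact: mul0r.
  left; exists (fun=> 0) => i; rewrite big1 => [|j _]; last by rewrite mulr0.
  by rewrite leNgt b0.
move=> Sm aS.
have [j0 j0S] : exists j, j \in S by apply/card_gt0P; rewrite Sm.
have [I' [c [c_ge0 c0 cx]]] := fourier_motzkin a b j0.
have [||[x Hx]|[y [y_ge0 y0 yb]]] :=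
    IH (S :\ j0) I' (fun r j => \sum_i c r i * a i j) (fun r => \sum_i c r i * b i).
- by apply: succn_inj; rewrite -Sm (cardsD1 j0 S) j0S.
- move=> r j; rewrite !inE negb_and negbK => /orP[/eqP->|/aS jS] //.
  by apply: big1 => i _; rewrite jS mulr0.
- left; have [|z Hz] := cx x; last by eexists=> i; exact: Hz.
  move=> r; apply: le_trans (Hx r); rewrite le_eqVlt; apply/orP; left; apply/eqP.
  under eq_bigr do rewrite mulr_sumr.
  rewrite exchange_big; apply: eq_bigr => j _ /=; rewrite mulr_suml.
  by apply: eq_bigr => i _; rewrite mulrA.
- right; exists (fun i => \sum_r y r * c r i).
  have E F : \sum_i (\sum_r y r * c r i) * F i = \sum_r y r * \sum_i c r i * F i.
    under eq_bigr do rewrite mulr_suml.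
    rewrite exchange_big; apply: eq_bigr => r _ /=; rewrite mulr_sumr.
    by apply: eq_bigr => i _; rewrite mulrA.
  split; last by rewrite E.
  + by move=> i; apply: sumr_ge0 => r _; rewrite mulr_ge0.
  + by move=> j; rewrite E.
Qed.

Section Duality.

Variables (I J : finType) (A : I -> J -> R) (b : I -> R) (c : J -> R).

Definition primal_feasible (x : J -> R) : Prop :=
  (forall j, 0 <= x j) /\ (forall i, \sum_j A i j * x j <= b i).

Definition dual_feasible_mx (y : I -> R) : Prop :=
  (forall i, 0 <= y i) /\ (forall j, c j <= \sum_i y i * A i j).

Lemma sum_mul_exchange (x : J -> R) (y : I -> R) :
  \sum_i y i * (\sum_j A i j * x j) = \sum_j (\sum_i y i * A i j) * x j.
Proof.
under eq_bigr do rewrite mulr_sumr.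
rewrite exchange_big; apply: eq_bigr => j _ /=; rewrite mulr_suml.
by apply: eq_bigr => i _; rewrite mulrA.
Qed.

(** Primal feasibility, dual feasibility and absence of a gap form a single system in [(x, y)].
    Suppose it has a Farkas certificate, with multiplier [tau] on the gap row. If [tau > 0], then
    [w / tau] and [u / tau] are feasible and violate weak duality. If [tau = 0], then [w] and [u]
    are recession directions, and testing them against [y0] and [x0] gives the contradiction. *)
Lemma strong_duality :
  (exists x, primal_feasible x) -> (exists y, dual_feasible_mx y) ->
  exists x y, [/\ primal_feasible x, dual_feasible_mx y
                & \sum_i y i * b i <= \sum_j c j * x j].
Proof.
move=> [x0 [x0_ge0 x0b]] [y0 [y0_ge0 y0c]].
pose delta (T : finType) (u w : T) : R := if u == w then 1 else 0.
(* Columns [inl] stand for [x] and columns [inr] for [y]. The rows are, in order: the primal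
   constraints, [x >= 0], the dual constraints, [y >= 0], and the gap row. *)
pose a (r : (I + J) + (J + I) + unit) (e : J + I) : R := match r, e with
  | inl (inl (inl i)), inl j => A i j
  | inl (inl (inr j)), inl j' => - delta J j' j
  | inl (inr (inl j)), inr i => - A i j
  | inl (inr (inr i)), inr i' => - delta I i' i
  | inr _, inl j => - c j
  | inr _, inr i => b i
  | _, _ => 0
  end.
pose d (r : (I + J) + (J + I) + unit) : R := match r with
  | inl (inl (inl i)) => b i
  | inl (inr (inl j)) => - c j
  | _ => 0
  end.
have deltaE (T : finType) (F : T -> R) u : \sum_w - delta T w u * F w = - F u.
  rewrite (bigD1 u) //= /delta eqxx big1 ?addr0 ?mulN1r // => w /negPf->.
  by rewrite oppr0 mul0r.
have deltaE' (T : finType) (F : T -> R) u : \sum_w F w * - delta T u w = - F u.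
  rewrite (bigD1 u) //= /delta eqxx big1 ?addr0 ?mulrN1 // => w.
  by rewrite eq_sym => /negPf->; rewrite oppr0 mulr0.
have sum_unit (F : unit -> R) : \sum_z F z = F tt.
  by rewrite (bigD1 tt) //= big1 ?addr0 // => -[].
have z0 (T : finType) (F : T -> R) : \sum_w 0 * F w = 0.
  by rewrite big1 // => w _; rewrite mul0r.
have z0' (T : finType) (F : T -> R) : \sum_w F w * 0 = 0.
  by rewrite big1 // => w _; rewrite mulr0.
have [[x Hx]|[y [y_ge0 ya yd]]] := farkas a d.
  exists (x \o inl), (x \o inr); split.
  - split=> [j|i].
      by have := Hx (inl (inl (inr j))); rewrite big_sumType /= deltaE z0 /=; lra.
    by have := Hx (inl (inl (inl i))); rewrite big_sumType /= z0 addr0.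
  - split=> [i|j].
      by have := Hx (inl (inr (inr i))); rewrite big_sumType /= deltaE z0 /=; lra.
    have := Hx (inl (inr (inl j))); rewrite big_sumType /= z0 add0r.
    under eq_bigr do rewrite mulNr mulrC.
    by rewrite sumrN lerN2.
  - have := Hx (inr tt); rewrite big_sumType /=.
    under eq_bigr do rewrite mulNr.
    rewrite sumrN addrC subr_le0.
    by under eq_bigr do rewrite mulrC.
pose u i := y (inl (inl (inl i))); pose w j := y (inl (inr (inl j))).
pose tau := y (inr tt).
have uA j : tau * c j <= \sum_i u i * A i j.
  have := ya (inl j); rewrite !big_sumType /= deltaE' !z0' sum_unit.
  have := y_ge0 (inl (inl (inr j))).
  rewrite -/tau; rewrite /u; lra.
have wA i : \sum_j A i j * w j <= tau * b i.
  have := ya (inr i); rewrite !big_sumType /= deltaE' !z0' sum_unit.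
  have := y_ge0 (inl (inr (inr i))).
  under [X in _ -> _ + (X + _) + _ = _ -> _]eq_bigr do rewrite mulrN mulrC.
  rewrite sumrN -/tau /w; lra.
have gap : \sum_i u i * b i < \sum_j c j * w j.
  move: yd; rewrite !big_sumType /= !z0'.
  under [X in _ + (X + _) + _ < _ -> _]eq_bigr do rewrite mulrN mulrC.
  by rewrite sumrN /u /w; lra.
have u_ge0 i : 0 <= u i by exact: y_ge0.
have w_ge0 j : 0 <= w j by exact: y_ge0.
have tau_ge0 : 0 <= tau by exact: y_ge0.
exfalso; have [tau0|tau_neq0] := eqVneq tau 0.
  have : \sum_i u i * \sum_j A i j * x0 j <= \sum_i u i * b i.
    by apply: ler_sum => i _; rewrite ler_wpM2l.
  rewrite sum_mul_exchange.
  have : 0 <= \sum_j (\sum_i u i * A i j) * x0 j.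
    apply: sumr_ge0 => j _; rewrite mulr_ge0 //.
    by apply: le_trans (uA j); rewrite tau0 mul0r.
  have : \sum_j c j * w j <= \sum_j (\sum_i y0 i * A i j) * w j.
    by apply: ler_sum => j _; rewrite ler_wpM2r.
  rewrite -sum_mul_exchange.
  have : \sum_i y0 i * (\sum_j A i j * w j) <= 0.
    rewrite -oppr_ge0 -sumrN; apply: sumr_ge0 => i _; rewrite -mulrN mulr_ge0 //.
    by rewrite oppr_ge0; apply: le_trans (wA i) _; rewrite tau0 mul0r.
  by move: gap; lra.
have tau_gt0 : 0 < tau by rewrite lt_def tau_neq0.
have : tau * \sum_j c j * w j <= \sum_j (\sum_i u i * A i j) * w j.
  rewrite mulr_sumr; apply: ler_sum => j _; rewrite mulrA.
  by rewrite ler_wpM2r.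
rewrite -sum_mul_exchange.
have : \sum_i u i * (\sum_j A i j * w j) <= tau * \sum_i u i * b i.
  rewrite mulr_sumr; apply: ler_sum => i _.
  by rewrite mulrCA ler_wpM2l.
by move: gap; rewrite -(ltr_pM2l tau_gt0); lra.
Qed.

End Duality.

End LinearInequalities.

(** * Sums and disjoint subsets *)

(* Abel summation. *)
Lemma sum_mul_ge0 (R : realFieldType) (m : nat) (v z : nat -> R) :
  (forall k, (k < m)%N -> 0 <= v k) ->
  (forall k l, (k <= l)%N -> (l < m)%N -> v l <= v k) ->
  (forall l, (l <= m)%N -> 0 <= \sum_(k < l) z k) ->
  0 <= \sum_(k < m) v k * z k.
Proof.
move=> v_ge0 vD z_ge0.
(* The bound [w] has to vary: the inductive step uses the hypothesis at [v l] and then lowers [v l]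
   to [w] against the nonnegative prefix sum up to [l] included. *)
suff H l w : (l <= m)%N -> 0 <= w -> (forall k, (k < l)%N -> w <= v k) ->
    w * (\sum_(k < l) z k) <= \sum_(k < l) v k * z k.
  by have := H m 0 (leqnn m) (lexx 0) v_ge0; rewrite mul0r.
elim: l w => [|l IH] w lm w_ge0 wv; first by rewrite !big_ord0 mulr0.
have vl_ge0 := v_ge0 l lm.
have := IH (v l) (ltnW lm) vl_ge0 (fun k kl => vD k l (ltnW kl) lm).
have := z_ge0 l.+1 lm; have := wv l (ltnSn l).
rewrite !big_ord_recr /=; nra.
Qed.

Lemma sum_mul_le (R : realFieldType) (m : nat) (v x y : nat -> R) :
  (forall k, (k < m)%N -> 0 <= v k) ->
  (forall k l, (k <= l)%N -> (l < m)%N -> v l <= v k) ->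
  (forall l, (l <= m)%N -> \sum_(k < l) x k <= \sum_(k < l) y k) ->
  \sum_(k < m) v k * x k <= \sum_(k < m) v k * y k.
Proof.
move=> v_ge0 vD xy; rewrite -subr_ge0 -sumrB.
under eq_bigr do rewrite -mulrBr.
apply: (sum_mul_ge0 (z := fun k => y k - x k)) => // l lm.
by rewrite sumrB subr_ge0 xy.
Qed.

Lemma sum_indicator (R : realFieldType) (m c : nat) (f : nat -> R) :
  (c <= m)%N -> \sum_(k < m) f k * (k < c)%N%:R = \sum_(k < c) f k.
Proof.
move=> cm; rewrite (big_ord_widen m f cm) [RHS]big_mkcond.
by apply: eq_bigr => k _; case: ifP; rewrite (mulr1, mulr0).
Qed.

(** Among entries in [[0, 1]] of total at most [c], the indicator of the first [c] ranks has the
    largest prefix sums. This bounds a fractional amount by whole copies. *)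
Lemma sum_mul_le_prefix (R : realFieldType) (m c : nat) (v x : nat -> R) :
  (forall k, (k < m)%N -> 0 <= v k) ->
  (forall k l, (k <= l)%N -> (l < m)%N -> v l <= v k) ->
  (forall k, (k < m)%N -> 0 <= x k <= 1) ->
  (c <= m)%N -> \sum_(k < m) x k <= c%:R ->
  \sum_(k < m) v k * x k <= \sum_(k < c) v k.
Proof.
move=> v_ge0 vD x01 cm xc; rewrite -(sum_indicator v cm).
pose y k : R := (k < c)%N%:R.
apply: (sum_mul_le (y := y)) => // l lm.
have [lc|cl] := leqP l c.
  apply: ler_sum => k _; rewrite /y (leq_trans (ltn_ord k) lc).
  by case/andP: (x01 k (leq_trans (ltn_ord k) lm)).
have -> : \sum_(k < l) y k = c%:R.
  have := sum_indicator (fun=> 1 : R) (ltnW cl).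
  under eq_bigr do rewrite mul1r.
  by move=> ->; rewrite sumr_const card_ord.
apply: le_trans xc; rewrite (big_ord_widen m x lm) [leRHS](bigID (fun k : 'I_m => (k < l)%N)) /=.
by rewrite lerDl sumr_ge0 // => k _; case/andP: (x01 k (ltn_ord k)).
Qed.

(* The units of mass [k, k.+1] are filled from left to right up to S. *)
Definition fill (R : realFieldType) (S : R) (k : nat) : R :=
  Num.max 0 (Num.min 1 (S - k%:R)).

Lemma fill_itv (R : realFieldType) (S : R) k : 0 <= fill S k <= 1.
Proof. by rewrite /fill le_max lexx /= ge_max ler01 ge_min lexx. Qed.

Lemma fill_fractional (R : realFieldType) (S : R) k l :
  fractional (fill S k) -> fractional (fill S l) -> k = l.
Proof.
have frac m : fractional (fill S m) -> m%:R < S < m.+1%:R.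
  rewrite /fractional /fill lt_max ltxx /= lt_min ltr01 subr_gt0 /=.
  rewrite gt_max ltr01 gt_min ltxx /= ltrBlDr -natr1 addrC => /andP[-> ->] //.
move=> /frac/andP[kS Sk] /frac/andP[lS Sl].
have lk : (l < k.+1)%N by rewrite -(ltr_nat R) (lt_trans lS).
have kl : (k < l.+1)%N by rewrite -(ltr_nat R) (lt_trans kS).
by apply/eqP; rewrite eqn_leq; apply/andP; split; rewrite -ltnS.
Qed.

Lemma sum_fill (R : realFieldType) (S : R) (l : nat) :
  0 <= S -> \sum_(k < l) fill S k = Num.min S l%:R.
Proof.
move=> S_ge0; elim: l => [|l IH]; first by rewrite big_ord0 min_r.
rewrite big_ord_recr IH /= /fill -natr1.
move: (l%:R) => u.
have [Su|uS] := leP S u.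
  by rewrite [X in Num.max 0 X]min_r ?max_l ?addr0 ?min_l //; lra.
have [S1|S1] := leP S (u + 1).
  by rewrite [X in Num.max 0 X]min_r ?max_r //; lra.
by rewrite [X in Num.max 0 X]min_l ?max_r //; lra.
Qed.

Lemma exists_min (R : realFieldType) (a : R) (r : seq R) :
  exists b, is_min b (a :: r).
Proof.
rewrite /is_min; elim: r a => [|a' r IH] a.
  by exists a; rewrite /= mem_head lexx.
have [b /andP[b_in /allP b_min]] := IH a'.
have [ab|ba] := leP a b; [exists a|exists b]; apply/andP; split.
- exact: mem_head.
- by apply/allP => z; rewrite inE => /orP[/eqP->|/b_min /(le_trans ab)].
- by rewrite inE b_in orbT.
- by apply/allP => z; rewrite inE => /orP[/eqP->|/b_min] //; exact: ltW.
Qed.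

Lemma disjoint_subsets (I T : finType) (S : {set T}) (N : {set I}) (d : I -> nat) :
  (\sum_(i in N) d i <= #|S|)%N ->
  exists F : I -> {set T},
    [/\ forall i, F i \subset S,
        forall i i', i \in N -> i' \in N -> i != i' -> [disjoint F i & F i']
      & forall i, i \in N -> #|F i| = d i].
Proof.
move: {2}#|N| (erefl #|N|) => m; elim: m N S => [|m IH] N S.
  move/eqP; rewrite cards_eq0 => /eqP-> _; exists (fun=> set0).
  by split=> [i|i i'|i]; rewrite ?sub0set ?inE.
move=> Nm; have [i0 i0N] : exists i, i \in N by apply/card_gt0P; rewrite Nm.
rewrite (big_setD1 i0) //= => dS.
pose S0 := [set x in take (d i0) (enum S)].
have S0S : S0 \subset S.
  by apply/subsetP => x; rewrite inE => /mem_take; rewrite mem_enum.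
have cS0 : #|S0| = d i0.
  rewrite cardsE (card_uniqP _) ?take_uniq ?enum_uniq // size_takel // -cardE.
  by apply: leq_trans dS; rewrite leq_addr.
have [||F [FS Fd Fc]] := IH (N :\ i0) (S :\: S0).
- by apply: succn_inj; rewrite -Nm (cardsD1 i0 N) i0N.
- by rewrite cardsD (setIidPr S0S) cS0 leq_subRL // (leq_trans _ dS) ?leq_addr.
have FS0 i : [disjoint F i & S0].
  by rewrite disjoint_subset; apply/subsetP => x /(subsetP (FS i)); rewrite !inE => /andP[].
exists (fun i => if i == i0 then S0 else F i); split.
- by move=> i; case: ifP => // _; apply: subset_trans (FS i) (subsetDl _ _).
- move=> i i' iN i'N ii'; case: eqVneq => [ei|ni]; case: eqVneq => [ei'|ni'] //.
  + by move: ii'; rewrite ei ei' eqxx.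
  + by rewrite disjoint_sym.
  + by apply: Fd; rewrite ?inE ?ni ?ni'.
- move=> i iN; case: eqVneq => [->|ni] //.
  by apply: Fc; rewrite !inE ni.
Qed.

(** * Cycles in the fractional allocation graph *)

Section Cycles.

Variables (R : realFieldType) (n t : nat) (K : 'I_t -> nat).
Variable x : 'I_n -> 'I_t -> nat -> R.

Local Notation e := (frac_edge K x).
Local Notation G := (graph_rel K x).
Local Notation cyc := (frac_cycle K x).

Definition avoiding (c : 'I_n + 'I_t) : rel ('I_n + 'I_t) :=
  [rel a b | [&& G a b, a != c & b != c]].

Lemma graph_rel_sym : symmetric G.
Proof. by move=> [i|j] [i'|j']. Qed.

Lemma avoiding_sym c : connect_sym (avoiding c).
Proof.
apply: sym_connect_sym => a b; rewrite /avoiding /= graph_rel_sym.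
by case: (a != c); rewrite ?andbF // andbT.
Qed.

Lemma path_avoiding c a p : c \notin a :: p -> path G a p ->
  connect (avoiding c) a (last a p).
Proof.
move=> cp Gp; apply/connectP; exists p => //.
apply: (@sub_in_path _ (predC1 c) G) => // [a' b' |].
  by rewrite !inE /avoiding /= => -> -> ->.
by apply/allP => b bp; apply: contraNneq cp => <-.
Qed.

(** The two lists of edges already have the shape of a cycle sequence and its [alternate]. The
    [subseq] clauses hand the distinctness of the vertices of [p] down to agents and goods
    separately. *)
Lemma alternating_path (i i' : 'I_n) p : path G (inl i) p -> last (inl i) p = inl i' ->
  exists ks js, [/\ size ks = size js, last i ks = i',
    subseq (map inl ks) p, subseq (map inr js) p
    & all (fun u => e u.1 u.2) (zip (belast i ks) js ++ zip ks js)].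
Proof.
have [m] := ubnP (size p); elim: m p i => // m IH [|[//|j] [|[i1|j1] p]] i pm //=; last by rewrite andbF.
  by move=> _ [->]; exists [::], [::].
move=> /and3P[eij ei1j Gp] lp.
have [|ks [js [sz lst s1 s2 /[!all_cat] /andP[a1 a2]]]] := IH p i1 _ Gp lp.
  by rewrite ltnS in pm; apply: ltn_trans pm => /=.
exists (i1 :: ks), (j :: js); split=> //=.
- by rewrite sz.
- by rewrite eqxx.
- by rewrite eqxx; apply: subseq_trans s2 (subseq_cons _ _).
- by rewrite eij all_cat /= ei1j a1 a2.
Qed.

Lemma cycle_through_good (i i' : 'I_n) j : i != i' -> e i j -> e i' j ->
  connect (avoiding (inr j)) (inl i) (inl i') -> exists s, cyc s.
Proof.
move=> ii' eij ei'j /connectP[p0 /shortenP[p pp Up _] lp].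
have Gp : path G (inl i) p by apply: sub_path pp => a b /= /and3P[].
have jp : inr j \notin p.
  move: pp; elim: p (inl i) {Up lp Gp} => //= b p IH a /andP[/and3P[_ _ bj] /IH].
  by rewrite inE negb_or eq_sym bj.
have [ks [js [sz lst s1 s2 /[!all_cat] /andP[a1 a2]]]] := alternating_path Gp (esym lp).
have si : size (i :: ks) = size (rcons js j) by rewrite size_rcons /= sz.
(* The good [j] closes the path: its edge to [i'] comes last in this sequence and its edge to [i]
   last in the alternate one. The length is at least 2 because [i != i']. *)
exists (zip (i :: ks) (rcons js j)).
rewrite /frac_cycle /alternate unzip1_zip ?unzip2_zip ?si // size_zip si minnn.
rewrite rot1_cons zip_rcons // {2}lastI zip_rcons ?size_belast // lst.
rewrite size_rcons -sz; apply/and4P; split.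
- by case: (ks) lst ii' => //= ->; rewrite eqxx.
- rewrite -(map_inj_uniq (@inl_inj 'I_n 'I_t)); apply: subseq_uniq Up.
  by rewrite /= eqxx.
- rewrite rcons_uniq; apply/andP; split.
    by apply: contra jp => jjs; apply: (mem_subseq s2); exact: map_f.
  rewrite -(map_inj_uniq (@inr_inj 'I_n 'I_t)); apply: subseq_uniq s2 _.
  by case/andP: Up.
- by rewrite all_cat !all_rcons /= ei'j a1 eij a2.
Qed.

(** The cycle is looked at from its good [j]: the path leaves [j] for an agent [i1 != i], and its
    rest, followed by the edge from [j'] to [i], joins [i1] to [i] without meeting [j]. *)
Lemma cycle_through_agent i j j' : j != j' -> e i j -> e i j' ->
  connect (avoiding (inl i)) (inr j) (inr j') -> exists s, cyc s.
Proof.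
move=> jj' eij eij' /connectP[p0 /shortenP[p pp Up _] lp].
case: p pp Up lp => [_ _ [jj]|[i1|j1] p] //=.
- by move: jj'; rewrite jj eqxx.
- move=> /andP[/and3P[Gji1 _ i1i] pp] /andP[jp _] lp.
  apply: (@cycle_through_good i i1 j) => //; first by apply: contraNneq i1i => ->.
  have Gp : path G (inl i1) p by apply: sub_path pp => a b /= /and3P[].
  rewrite avoiding_sym; apply: connect_trans (path_avoiding jp Gp) _.
  rewrite -lp; apply: connect1; rewrite /avoiding /= eij' /=.
  by rewrite andbT; apply: contraNneq jj' => -[->].
Qed.

(** Distinct agents bound the length of a cycle by [n], so the search is finite. *)
Lemma frac_cycleP : (exists s, cyc s) \/ (forall s, ~~ cyc s).
Proof.
case: (boolP [exists m : 'I_n.+1, [exists s : m.-tuple ('I_n * 'I_t), cyc s]]).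
  by move=> /existsP[m /existsP[s cs]]; left; exists s.
move=> no; right=> s; apply: contra no => cs.
have sn : (size s < n.+1)%N.
  have /and4P[_ U _ _] := cs.
  rewrite ltnS -(size_map fst s) -(card_uniqP U) -[leqRHS]card_ord.
  exact: max_card.
apply/existsP; exists (Ordinal sn); apply/existsP; by exists (in_tuple s).
Qed.

(** Traversing the cycle backwards exchanges subtracted and added edges. This is needed because
    [cancel_amount] requires the minimum weight to occur on a subtracted edge. *)
Lemma frac_cycle_rev s : cyc s ->
  exists s', [/\ cyc s', perm_eq s' (alternate s) & perm_eq (alternate s') s].
Proof.
move=> /and4P[s1 U1 U2 ec].
have sz : size (rot 1 (unzip1 s)) = size (unzip2 s) by rewrite size_rot !size_map.
have sz' : size (rev (rot 1 (unzip1 s))) = size (rev (unzip2 s)) by rewrite !size_rev.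
have rr : rev (alternate s) = zip (rev (rot 1 (unzip1 s))) (rev (unzip2 s)).
  by rewrite rev_zip.
have p1 : perm_eq (rev (alternate s)) (alternate s) by rewrite perm_rev.
have ar : alternate (rev (alternate s)) = rev s.
  rewrite {1}/alternate rr unzip1_zip ?unzip2_zip ?sz' //.
  rewrite rev_rot -[rot 1 _]/(rot 1 (rotr 1 _)) rotrK -rev_zip ?size_map //.
  by rewrite zip_unzip.
have p2 : perm_eq (alternate (rev (alternate s))) s by rewrite ar perm_rev.
exists (rev (alternate s)); split=> //; apply/and4P; split.
- by rewrite size_rev /alternate size_zip sz minnn size_map.
- by rewrite rr unzip1_zip ?sz' // rev_uniq rot_uniq.
- by rewrite rr unzip2_zip ?sz' // rev_uniq.
- by rewrite (perm_all _ (perm_cat p1 p2)) (perm_all _ (permEl (perm_catC _ _))).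
Qed.

(** As goods are distinct, a common edge would occupy the same position in both lists, so that two
    cyclically consecutive agents would coincide. *)
Lemma alternate_disjoint s u : cyc s -> u \in s -> u \notin alternate s.
Proof.
move=> /and4P[s1 U1 U2 _] us; apply/negP => ua.
have [a [b u12]] : exists a b, u = (a, b) by exists u.1, u.2; case: u {us ua}.
subst u; have := us; have := ua.
move=> /(nthP (a, b)) [k].
have sz : size (rot 1 (unzip1 s)) = size (unzip2 s) by rewrite size_rot !size_map.
rewrite /alternate size_zip sz minnn size_map => ks.
rewrite nth_zip // => -[ka kb].
move=> /(nthP (a, b)) [l ls lab].
have lb : nth b (unzip2 s) l = b by rewrite (nth_map (a, b)) // lab.
have la : nth a (unzip1 s) l = a by rewrite (nth_map (a, b)) // lab.
have kl : k = l.
  by apply/eqP; rewrite -(nth_uniq b _ _ U2) ?size_map // kb lb.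
subst l; move: ka; case: (s) s1 U1 ks la => [|u [|u' r]] // _ U1 ks la.
rewrite /= rot1_cons nth_rcons /=.
have U1' : uniq (u.1 :: u'.1 :: unzip1 r) by [].
move: ks; rewrite /= ltnS leq_eqVlt => /orP[/eqP kr|kr].
  rewrite kr size_map ltnn eqxx => ua'.
  have : nth a (u.1 :: u'.1 :: unzip1 r) k = nth a (u.1 :: u'.1 :: unzip1 r) 0 by rewrite la.
  move/eqP; rewrite nth_uniq //= ?size_map ?kr //.
rewrite size_map kr => ka.
have : nth a (u.1 :: u'.1 :: unzip1 r) k = nth a (u.1 :: u'.1 :: unzip1 r) k.+1 by rewrite la.
by move/eqP; rewrite nth_uniq //= ?size_map ?ltnS // ?ltn_eqF // ltnW // ltnS.
Qed.

Hypothesis acyclic : forall s, ~~ cyc s.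

Lemma no_cycle : ~ exists s, cyc s.
Proof. by case=> s; apply/negP. Qed.

Variables (N roots : {set 'I_n}).
Hypothesis edgeN : forall i j, e i j -> i \in N.
Hypothesis rooted : rooting K N x roots.

Lemma child_avoiding i j : child K x roots i j ->
  e i j /\ exists2 r, r \in roots & connect (avoiding (inr j)) (inl r) (inl i).
Proof. by move=> /andP[eij /existsP[r /andP[rr c]]]; split=> //; exists r. Qed.

Lemma avoiding_connect c a b : connect (avoiding c) a b -> connect G a b.
Proof. by apply: connect_sub => a' b' /= /and3P[Gab _ _]; exact: connect1. Qed.

(** Both parents lie in the tree of [j] and hence have the same root. Their paths from it avoid [j],
    so together they join [i] to [i'] away from [j] and close a cycle. *)
Lemma child_unique_parent i i' j :
  child K x roots i j -> child K x roots i' j -> i = i'.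
Proof.
move=> /child_avoiding[eij [r rr ri]] /child_avoiding[ei'j [r' rr' ri']].
apply/eqP; apply: contraT => ii'; exfalso; apply: no_cycle.
have rr'E : r = r'.
  have [rN uniq_root] := rooted.
  have /eqP/cards1P[r0 Er0] := uniq_root r' (subsetP rN _ rr').
  have : r' \in [set r0] by rewrite -Er0 inE rr' connect0.
  have : r \in [set r0].
    rewrite -Er0 inE rr; apply: connect_trans (avoiding_connect ri) _.
    have : connect G (inl i) (inr j) by apply: connect1.
    move=> /connect_trans; apply.
    have : connect G (inr j) (inl i') by apply: connect1.
    move=> /connect_trans; apply.
    rewrite (sym_connect_sym graph_rel_sym); exact: avoiding_connect ri'.
  by rewrite !inE => /eqP-> /eqP->.
subst r'; apply: (@cycle_through_good i i' j) => //.
by apply: connect_trans ri'; rewrite avoiding_sym.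
Qed.

(* The only neighbour of i that is not a child is the last vertex before i on
   the path from the root. *)
Lemma nonchild_unique i j j' : e i j -> e i j' ->
  ~~ child K x roots i j -> ~~ child K x roots i j' -> j = j'.
Proof.
move=> eij eij' cj cj'.
have [rN uniq_root] := rooted.
have [r] : exists r, r \in [set r in roots | connect G (inl r) (inl i)].
  by apply/card_gt0P; rewrite uniq_root // (edgeN eij).
rewrite inE => /andP[rr /connectP[p0 /shortenP[p Gp Up _] lp]].
case/lastP: p Gp Up lp => [_ _ [ri]|p b].
  by case/negP: cj; rewrite /child eij; apply/existsP; exists r; rewrite rr ri connect0.
rewrite last_rcons rcons_path => /andP[Gp lb] Up Eb; subst b.
case E: (last (inl r) p) lb => [//|j0] eij0.
move: Up; rewrite -rcons_cons rcons_uniq => /andP[ip Up].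
suff H l : e i l -> ~~ child K x roots i l -> l = j0 by rewrite (H j) // (H j').
move=> eil cl; apply/eqP; apply: contraT => lj0; exfalso; apply: no_cycle.
(* If the path from the root misses [l], it witnesses that [l] is a child. Otherwise its stretch
   from [l] to [j0] avoids [i], and both ends are neighbours of [i]. *)
have [lp|lp] := boolP (inr l \in (inl r :: p)); last first.
  case/negP: cl; rewrite /child eil; apply/existsP; exists r; rewrite rr /=.
  rewrite -[X in connect _ _ X](last_rcons (inl r) p).
  apply: (path_avoiding (c := inr l)).
    by rewrite -rcons_cons mem_rcons inE negb_or lp andbT.
  by rewrite rcons_path Gp E.
move: lp; rewrite inE /= => lp.
case/splitPr: lp Gp ip E {Up} => p1 p2.
rewrite cat_path /= => /and3P[_ _ Gp2] ip; rewrite last_cat /= => E.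
apply: (@cycle_through_agent i l j0) => //; rewrite -E; apply: path_avoiding => //.
by apply: contra ip => ip2; rewrite inE mem_cat ip2 !orbT.
Qed.

End Cycles.

Lemma rooting_exists (R : realFieldType) (n t : nat) (K : 'I_t -> nat)
    (x : 'I_n -> 'I_t -> nat -> R) (N : {set 'I_n}) :
  exists roots, rooting K N x roots.
Proof.
pose G := graph_rel K x.
have Gsym : connect_sym G by apply: sym_connect_sym; exact: graph_rel_sym.
(* The result of [pick] depends only on the extension of the predicate, so all active agents of one
   component choose the same root. *)
pose rt i := odflt i [pick r in N | connect G (inl r) (inl i)].
have rtP i : i \in N -> rt i \in N /\ connect G (inl (rt i)) (inl i).
  by move=> iN; rewrite /rt; case: pickP => [r /andP[]|/(_ i)] //=; rewrite iN connect0.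
have rtE i i' : i \in N -> i' \in N -> connect G (inl i) (inl i') -> rt i = rt i'.
  move=> iN i'N ii'; rewrite /rt (@eq_pick _ _ (fun r => (r \in N) && connect G (inl r) (inl i'))).
    by case: pickP => // /(_ i'); rewrite i'N connect0.
  by move=> r /=; rewrite ![connect G (inl r) _]Gsym (same_connect Gsym ii').
exists (rt @: N); split.
  by apply/subsetP => _ /imsetP[i iN ->]; case: (rtP i iN).
move=> i iN; apply/eqP/cards1P; exists (rt i); apply/setP => r; rewrite !inE.
apply/andP/eqP => [[/imsetP[i' i'N ->] c]|->].
  apply: rtE => //; have [_ c'] := rtP i' i'N.
  by rewrite Gsym in c'; exact: connect_trans c' c.
by split; [exact: imset_f|case: (rtP i iN)].
Qed.

(** * Duality for the allocation program *)

Lemma sum_pair_sig (R : realFieldType) (n t : nat) (m : 'I_t -> nat)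
    (F : 'I_n * {j : 'I_t & 'I_(m j)} -> R) :
  \sum_e F e = \sum_i \sum_j \sum_(k < m j) F (i, Tagged (fun j => 'I_(m j)) k).
Proof.
have := @pair_big R 0 +%R 'I_n {j : 'I_t & 'I_(m j)} xpredT xpredT (fun i d => F (i, d)).
rewrite (eq_bigr F) => [<-|[] //]; apply: eq_bigr => i _.
have := @sig_big_dep R 0 +%R 'I_t (fun j => 'I_(m j)) xpredT (fun=> xpredT)
  (fun j k => F (i, Tagged (fun j => 'I_(m j)) k)).
by move=> /= ->; apply: eq_bigr => -[].
Qed.

Section Program.

Variables (R : realFieldType) (n t : nat) (K : 'I_t -> nat).
Variables (v : 'I_n -> 'I_t -> nat -> R) (mu : 'I_n -> R).
Variables (N : {set 'I_n}) (C : {set copy K}).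

Local Notation m := (supply C).

Lemma supply_le j : (m j <= K j)%N.
Proof.
apply: leq_trans (subset_leq_card (subsetIr _ _)) _.
have -> : copies_of K j = [set Tagged (fun j => 'I_(K j)) k | k : 'I_(K j)].
  apply/setP => -[j' k]; rewrite inE /=; apply/eqP/imsetP => [jj'|[k' _ /(congr1 tag)] //].
  by subst j'; exists k.
by apply: leq_trans (leq_imset_card _ _) _; rewrite card_ord.
Qed.

Lemma sum_single (I : finType) (i0 : I) (F : I -> R) :
  \sum_i (if i == i0 then F i else 0) = F i0.
Proof.
by rewrite (bigD1 i0) //= eqxx big1 ?addr0 // => i /negPf->.
Qed.

Lemma sum_single' (I : finType) (i0 : I) (F : I -> R) :
  \sum_i (if i0 == i then F i else 0) = F i0.
Proof. by under eq_bigr do rewrite eq_sym; exact: sum_single. Qed.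

(** The allocation program is put in matrix form with index types independent of [N]: an inactive
    agent keeps her variables, but the right-hand side of their capacity rows is 0 and all their
    other coefficients vanish. *)
Lemma program_duality : splc K v ->
  (exists x, lp_feasible v mu N C x) ->
  exists x alpha p q,
    [/\ lp_feasible v mu N C x, dual_feasible v N C alpha p q
      & dual_objective mu N C alpha p q <= \sum_(i in N) lp_value v C x i].
Proof.
move=> [v_ge0 _] [x0 [x0b x0mu x0s]].
pose V := ('I_n * {j : 'I_t & 'I_(m j)})%type.
pose tg j (k : 'I_(m j)) := Tagged (fun j => 'I_(m j)) k.
pose A (r : 'I_n + 'I_t + V) (e : V) : R := match r with
  | inl (inl i) => if e.1 == i then
      (if i \in N then - v i (tag e.2) (tagged e.2) else 0) else 0
  | inl (inr j) => if e.1 \in N then (if tag e.2 == j then 1 else 0) else 0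
  | inr e' => if e == e' then 1 else 0
  end.
pose b (r : 'I_n + 'I_t + V) : R := match r with
  | inl (inl i) => if i \in N then - mu i else 0
  | inl (inr j) => (m j)%:R
  | inr e => if e.1 \in N then 1 else 0
  end.
pose c (e : V) : R := if e.1 \in N then v e.1 (tag e.2) (tagged e.2) else 0.
have sumV (F : V -> R) : \sum_e F e = \sum_i \sum_j \sum_(k < m j) F (i, tg j k).
  exact: sum_pair_sig.
have rowA i X : \sum_e A (inl (inl i)) e * X e =
    if i \in N then - \sum_j \sum_(k < m j) v i j k * X (i, tg j k) else 0.
  rewrite sumV; transitivity (\sum_i' if i' == i then \sum_j \sum_(k < m j)
      (if i \in N then - v i j k else 0) * X (i', tg j k) else 0).
    apply: eq_bigr => i' _ /=; case: eqP => // _.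
    by rewrite big1 // => j _; rewrite big1 // => k _; rewrite mul0r.
  rewrite sum_single; case: ifP => iN.
    rewrite -sumrN; apply: eq_bigr => j _; rewrite -sumrN; apply: eq_bigr => k _.
    by rewrite mulNr.
  by rewrite big1 // => j _; rewrite big1 // => k _; rewrite mul0r.
have rowS j X : \sum_e A (inl (inr j)) e * X e =
    \sum_(i in N) \sum_(k < m j) X (i, tg j k).
  rewrite sumV /= [RHS]big_mkcond; apply: eq_bigr => i _; case: ifP => iN; last first.
    by rewrite big1 // => j' _; rewrite big1 // => k _; rewrite mul0r.
  rewrite -(sum_single j (fun j => \sum_(k < m j) X (i, tg j k))).
  apply: eq_bigr => j' _; case: eqP => _; last first.
    by rewrite big1 // => k _; rewrite mul0r.
  by apply: eq_bigr => k _; rewrite mul1r.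
have rowU e X : \sum_e' A (inr e) e' * X e' = X e.
  rewrite -(sum_single e X); apply: eq_bigr => e' _ /=.
  by case: ifP; rewrite (mul1r, mul0r).
have col Y e : \sum_r Y r * A r e =
    (if e.1 \in N then Y (inl (inr (tag e.2)))
       - Y (inl (inl e.1)) * v e.1 (tag e.2) (tagged e.2) else 0) + Y (inr e).
  rewrite !big_sumType /=; congr (_ + _); last first.
    rewrite -(sum_single' e (fun e => Y (inr e))); apply: eq_bigr => e' _.
    by case: ifP; rewrite (mulr1, mulr0).
  under eq_bigr do rewrite (fun_if (fun z => _ * z)) mulr0.
  rewrite sum_single'; case: ifP => iN.
    rewrite addrC mulrN; congr (_ - _).
    rewrite -(sum_single' (tag e.2) (fun j => Y (inl (inr j)))); apply: eq_bigr => j _.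
    by case: ifP; rewrite (mulr1, mulr0).
  by rewrite mulr0 add0r big1 // => j _; rewrite mulr0.
have objE X : \sum_e c e * X e =
    \sum_(i in N) \sum_j \sum_(k < m j) v i j k * X (i, tg j k).
  rewrite sumV [RHS]big_mkcond; apply: eq_bigr => i _; rewrite /c /=; case: ifP => // _.
  by rewrite big1 // => j _; rewrite big1 // => k _; rewrite mul0r.
have objY Y : \sum_r Y r * b r =
    - (\sum_(i in N) Y (inl (inl i)) * mu i) + \sum_j (m j)%:R * Y (inl (inr j))
    + \sum_(i in N) \sum_j \sum_(k < m j) Y (inr (i, tg j k)).
  rewrite !big_sumType /=; congr (_ + _ + _).
  - rewrite -sumrN [RHS]big_mkcond; apply: eq_bigr => i _.
    by case: ifP; rewrite (mulr0, mulrN).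
  - by apply: eq_bigr => j _; rewrite mulrC.
  - rewrite sumV [RHS]big_mkcond; apply: eq_bigr => i _ /=; case: ifP => iN.
      by apply: eq_bigr => j _; apply: eq_bigr => k _; rewrite mulr1.
    by rewrite big1 // => j _; rewrite big1 // => k _; rewrite mulr0.
have [||X [Y [[X_ge0 Xb] [Y_ge0 Yc] XY]]] := @strong_duality R _ _ A b c.
- exists (fun e : V => x0 e.1 (tag e.2) (tagged e.2)); split=> [e|[[i|j]|e]].
  + by have := x0b e.1 (tag e.2) (tagged e.2); case: ifP => [_ /andP[]|_ /eqP->].
  + by rewrite rowA /=; case: ifP => // iN; rewrite lerN2; exact: x0mu.
  + by rewrite rowS; exact: x0s.
  + rewrite rowU /=; have := x0b e.1 (tag e.2) (tagged e.2).
    by rewrite ltn_ord andbT; case: ifP => [_ /andP[]|_ /eqP->].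
(* Dual feasibility is witnessed by [q = v] on active agents with [alpha = 0] and [p = 0]. *)
- exists (fun r => if r is inr e then c e else 0); split.
    move=> [[i|j]|e] //; rewrite /c; case: ifP => // _.
    by apply: v_ge0; apply: leq_trans (supply_le _).
  by move=> e; rewrite col mul0r subrr if_same add0r.
pose ext j (f : 'I_(m j) -> R) k := if insub k is Some k' then f k' else 0.
have extE j f (k : 'I_(m j)) : ext j f k = f k by rewrite /ext valK.
pose x i j k := if i \in N then ext j (fun k => X (i, tg j k)) k else 0.
have xE i j (k : 'I_(m j)) : i \in N -> x i j k = X (i, tg j k).
  by move=> iN; rewrite /x iN extE.
have valE i : i \in N ->
    lp_value v C x i = \sum_j \sum_(k < m j) v i j k * X (i, tg j k).
  by move=> iN; apply: eq_bigr => j _; apply: eq_bigr => k _; rewrite xE.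
exists x, (fun i => Y (inl (inl i))), (fun j => Y (inl (inr j))),
  (fun i j => ext j (fun k => Y (inr (i, tg j k)))).
split; first split.
- move=> i j k; have [iN|iN] /= := boolP (i \in N); last by rewrite /x (negPf iN).
  case: ifP => km; last by rewrite /x iN /ext insubF.
  rewrite (xE i j (Ordinal km) iN) X_ge0 /=.
  by have := Xb (inr (i, tg j (Ordinal km))); rewrite rowU /= iN.
- by move=> i iN; have := Xb (inl (inl i)); rewrite rowA /= iN lerN2 valE.
- move=> j; have := Xb (inl (inr j)); rewrite rowS /=.
  by under eq_bigr => i iN do under eq_bigr => k _ do rewrite -xE //.
- split.
  + by move=> i _; exact: Y_ge0.
  + by move=> j; exact: Y_ge0.
  + by move=> i j k iN km; rewrite (extE j _ (Ordinal km)); exact: Y_ge0.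
  + move=> i j k iN km; have := Yc (i, tg j (Ordinal km)).
    by rewrite col /c /= iN (extE j _ (Ordinal km)); lra.
- rewrite /dual_objective (eq_bigr _ valE); move: XY; rewrite objE objY => XY.
  under [X in _ + X - _]eq_bigr => i _ do
    under eq_bigr => j _ do under eq_bigr => k _ do rewrite extE.
  by move: XY; lra.
Qed.

Lemma fractional_support (x : 'I_n -> 'I_t -> nat -> R) i j k :
  bounded N C x -> fractional (x i j k) -> i \in N /\ (k < m j)%N.
Proof.
move=> xb xf; apply/andP; apply: contraT => /negPf iF; have := xb i j k.
by rewrite iF => /eqP x0; move: xf; rewrite x0 /fractional ltxx.
Qed.

(** * Weak duality and complementary slackness *)

Section Slack.

Variables (alpha : 'I_n -> R) (p : 'I_t -> R) (q x : 'I_n -> 'I_t -> nat -> R).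
Hypothesis dual : dual_feasible v N C alpha p q.
Hypothesis primal : lp_feasible v mu N C x.

(* This is [(p + q - v - alpha v) x + q (1 - x)]. *)
Definition slack i j k : R :=
  p j * x i j k + q i j k - (1 + alpha i) * v i j k * x i j k.

Lemma slack_ge0 i j k : i \in N -> (k < m j)%N -> 0 <= slack i j k.
Proof.
move=> iN km; have [_ _ q_ge0 d] := dual; have [xb _ _] := primal.
have := xb i j k; rewrite iN km /= => /andP[x_ge0 x_le1].
have := d i j k iN km; have := q_ge0 i j k iN km.
rewrite /slack; nra.
Qed.

(** The gap is the total slack plus two nonnegative terms: prices times unsold supply, and [alpha]
    times the value in excess of [mu]. Weak duality and complementary slackness both follow from
    this decomposition. *)
Lemma sum_slack_le : \sum_(i in N) \sum_j \sum_(k < m j) slack i j k <=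
  dual_objective mu N C alpha p q - \sum_(i in N) lp_value v C x i.
Proof.
have [a_ge0 p_ge0 _ _] := dual; have [_ xmu xs] := primal.
have -> : \sum_(i in N) \sum_j \sum_(k < m j) slack i j k =
    \sum_j p j * (\sum_(i in N) \sum_(k < m j) x i j k)
    + \sum_(i in N) \sum_j \sum_(k < m j) q i j k
    - \sum_(i in N) (1 + alpha i) * lp_value v C x i.
  have -> : \sum_j p j * (\sum_(i in N) \sum_(k < m j) x i j k) =
      \sum_(i in N) \sum_j p j * (\sum_(k < m j) x i j k).
    by rewrite exchange_big; apply: eq_bigr => j _; rewrite mulr_sumr.
  rewrite -big_split -sumrB /=; apply: eq_bigr => i _.
  rewrite mulr_sumr -big_split -sumrB /=; apply: eq_bigr => j _.
  rewrite !mulr_sumr -big_split -sumrB /=; apply: eq_bigr => k _.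
  by rewrite /slack mulrA.
have sup : \sum_j p j * (\sum_(i in N) \sum_(k < m j) x i j k)
    <= \sum_j (m j)%:R * p j.
  by apply: ler_sum => j _; rewrite [leRHS]mulrC ler_wpM2l.
have val : \sum_(i in N) lp_value v C x i + \sum_(i in N) alpha i * mu i
    <= \sum_(i in N) (1 + alpha i) * lp_value v C x i.
  rewrite -big_split; apply: ler_sum => i iN /=.
  by rewrite mulrDl mul1r lerD2l ler_wpM2l ?a_ge0 ?xmu.
by rewrite /dual_objective; lra.
Qed.

Lemma weak_duality :
  \sum_(i in N) lp_value v C x i <= dual_objective mu N C alpha p q.
Proof.
rewrite -subr_ge0; apply: le_trans sum_slack_le; apply: sumr_ge0 => i iN.
by apply: sumr_ge0 => j _; apply: sumr_ge0 => k _; exact: slack_ge0.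
Qed.

(** Without gap every slack vanishes. For [0 < x < 1] the summand [q (1 - x)] then forces [q = 0],
    and the other one forces equality in the dual constraint. *)
Lemma complementary_slackness :
  dual_objective mu N C alpha p q <= \sum_(i in N) lp_value v C x i ->
  forall i j k, fractional (x i j k) -> (1 + alpha i) * v i j k = p j.
Proof.
move=> gap i j k xfrac.
have [_ _ q_ge0 d] := dual; have [xb _ _] := primal.
have [iN km] := fractional_support xb xfrac.
have sumT : \sum_(i in N) \sum_j \sum_(k < m j) slack i j k <= 0.
  by apply: le_trans sum_slack_le _; rewrite subr_le0.
have T0 : slack i j k <= 0.
  apply: le_trans sumT; rewrite (bigD1 i) //= (bigD1 j) //= (bigD1 (Ordinal km)) //=.
  rewrite -[leLHS]addr0 -[leLHS]addr0 -[leLHS]addr0 !lerD //.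
  - by apply: sumr_ge0 => k' _; exact: slack_ge0.
  - by apply: sumr_ge0 => j' _; apply: sumr_ge0 => k' _; exact: slack_ge0.
  - apply: sumr_ge0 => i' /andP[i'N _].
    by apply: sumr_ge0 => j' _; apply: sumr_ge0 => k' _; exact: slack_ge0.
have := d i j k iN km; have := q_ge0 i j k iN km.
case/andP: xfrac; rewrite /slack in T0; move: T0.
set w := (1 + alpha i) * v i j k => T0 x_gt0 x_lt1 q0 d0.
have d' : w <= p j + q i j k by rewrite /w; lra.
have qx : 0 <= q i j k * (1 - x i j k) by rewrite mulr_ge0 //; lra.
have sx : 0 <= (p j + q i j k - w) * x i j k by rewrite mulr_ge0; lra.
have /eqP : q i j k * (1 - x i j k) = 0 by lra.
have /eqP : (p j + q i j k - w) * x i j k = 0 by lra.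
rewrite !mulf_eq0 => /orP[/eqP ?|/eqP ?]; last lra.
by move=> /orP[/eqP ?|/eqP ?]; lra.
Qed.

End Slack.

End Program.

(** * Maximin shares and feasibility *)

Section Shares.

Variables (R : realFieldType) (n t : nat) (K : 'I_t -> nat).
Variables (v : 'I_n -> 'I_t -> nat -> R) (hv : splc K v).

Local Notation m := (supply (K := K)).

Lemma value_ge0 i (S : {set copy K}) : 0 <= value v i S.
Proof.
apply: sumr_ge0 => j _; apply: sumr_ge0 => k _; apply: hv.1.
exact: leq_trans (ltn_ord k) (supply_le S j).
Qed.

Lemma value1 i c : value v i [set c : copy K] = v i (tag c) 0%N.
Proof.
rewrite /value (bigD1 (tag c)) //= [X in _ + X]big1 ?addr0 => [|j jc].
  have -> : [set c] :&: copies_of K (tag c) = [set c].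
    by apply/setIidPl; rewrite sub1set inE.
  by rewrite cards1 big_ord_recl big_ord0 addr0.
have -> : [set c] :&: copies_of K j = set0.
  apply/setP => c'; rewrite !inE; apply/andP => -[/eqP-> /eqP cj].
  by rewrite cj eqxx in jc.
by rewrite cards0 big_ord0.
Qed.

Lemma mms_attained i : exists B : copy K -> 'I_n,
  forall k, mms K v i <= value v i (B @^-1: [set k]).
Proof.
rewrite /mms; elim/big_ind: _ => [|a b [B Ba] [B' Bb]|B _].
(* The default 0 of the maximum is guaranteed by any partition, as values are nonnegative. *)
- by exists (fun=> i) => k; exact: value_ge0.
- by case: (leP a b) => _; [exists B'|exists B].
- by exists B => k; exact: bigmin_le.
Qed.

Lemma mms_ge0 i : 0 <= mms K v i.
Proof. exact: bigmax_ge_id. Qed.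

Variable mu : 'I_n -> R.

Implicit Types (N : {set 'I_n}) (C : {set copy K}).

(** The invariant of the reductions. The elements of [T] are labels of parts of [B], not agents
    being served; each reduction costs one agent and at most one label, so [#|N| <= #|T|]
    persists. *)
Definition shared (N : {set 'I_n}) (C : {set copy K}) : Prop :=
  forall i, i \in N -> exists (T : {set 'I_n}) (B : copy K -> 'I_n),
    (#|N| <= #|T|)%N /\ forall k, k \in T -> mu i <= value v i (C :&: B @^-1: [set k]).

(* The part of the partition that contained c is dropped. *)
Lemma shared_reduce N C i0 c : i0 \in N -> shared N C -> shared (N :\ i0) (C :\ c).
Proof.
move=> i0N sh i; rewrite !inE => /andP[_ iN].
have [T [B [NT TB]]] := sh i iN.
exists (T :\ B c), B; split=> [|k].
  rewrite (cardsD1 i0 N) i0N (cardsD1 (B c) T) in NT.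
  by rewrite -ltnS; apply: leq_trans NT _; case: (B c \in T).
rewrite !inE => /andP[kBc /TB]; congr (_ <= value v i _).
apply/setP => c'; rewrite !inE; case: (eqVneq c' c) => [->|//] /=.
by rewrite [B c == k]eq_sym (negPf kBc) andbF.
Qed.

(* Agent i averages her partition over the parts in T and hence gets at most a
   fraction 1 / #|N| of every good. *)
Lemma shared_feasible N C : shared N C -> exists x, lp_feasible v mu N C x.
Proof.
move=> sh.
have H i : exists z : 'I_t -> nat -> R, i \in N ->
    [/\ forall j k, 0 <= z j k <= 1,
        mu i <= \sum_j \sum_(k < m C j) v i j k * z j k
      & forall j, \sum_(k < m C j) z j k <= (m C j)%:R / #|N|%:R].
  have [iN|iN] := boolP (i \in N); last by exists (fun _ _ => 0).
  have [T [B [NT TB]]] := sh i iN.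
  have N_gt0 : (0 < #|N|)%N by apply/card_gt0P; exists i.
  have T_gt0 : 0 < #|T|%:R :> R by rewrite ltr0n (leq_trans N_gt0).
  pose c l j := supply (C :&: B @^-1: [set l]) j.
  have cm l j : (c l j <= m C j)%N by apply/subset_leq_card/setSI/subsetIl.
  (* A part with [c l j] copies of [j] corresponds to the indicator of the first [c l j] ranks, so
     the value of this average is exactly the average value of the parts. *)
  exists (fun j k => (\sum_(l in T) (k < c l j)%N%:R) / #|T|%:R) => _; split.
  - move=> j k; rewrite divr_ge0 ?ler0n ?sumr_ge0 //= ler_pdivrMr // mul1r.
    rewrite -sumr_const; apply: ler_sum => l _.
    by case: (_ < _)%N.
  - have -> : \sum_j \sum_(k < m C j) v i j k *
          ((\sum_(l in T) (k < c l j)%N%:R) / #|T|%:R) =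
        (\sum_(l in T) value v i (C :&: B @^-1: [set l])) / #|T|%:R.
      symmetry; rewrite mulr_suml /value.
      under eq_bigr => l _ do rewrite mulr_suml.
      rewrite exchange_big; apply: eq_bigr => j _ /=.
      under eq_bigr => l _ do
        rewrite -/(supply _ j) -/(c l j) -(sum_indicator (v i j) (cm l j)) mulr_suml.
      rewrite exchange_big; apply: eq_bigr => k _ /=.
      by rewrite mulr_suml mulr_sumr; apply: eq_bigr => l _; rewrite mulrA.
    rewrite ler_pdivlMr // mulr_natr -sumr_const; exact: ler_sum.
  - move=> j; rewrite -mulr_suml exchange_big /=.
    have E l : \sum_(k < m C j) (k < c l j)%N%:R = (c l j)%:R :> R.
      have := sum_indicator (fun=> 1 : R) (cm l j).
      under eq_bigr do rewrite mul1r.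
      by move=> ->; rewrite sumr_const card_ord.
    under eq_bigr do rewrite E.
    rewrite -natr_sum; apply: ler_pM; rewrite ?invr_ge0 ?ler0n //; last first.
      by rewrite lef_pV2 ?posrE ?ler_nat // ltr0n.
    rewrite ler_nat; apply: leq_trans (_ : \sum_l c l j <= _)%N.
      by rewrite [leqRHS](bigID (mem T)) leq_addr.
    rewrite /supply -[leqRHS]sum1_card (partition_big B xpredT) //=.
    apply: leq_sum => l _; rewrite /c /supply -sum1_card; apply/eq_leq/eq_bigl => d.
    by rewrite !inE -!andbA; congr (_ && _); rewrite andbC.
have [z Hz] := fin_all_exists H.
exists (fun i j k => if (i \in N) && (k < m C j)%N then z i j k else 0).
split.
- move=> i j k; case: (boolP (_ && _)) => /= [/andP[iN _]|_] //.
  by have [z01 _ _] := Hz i iN; exact: z01.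
- move=> i iN; have [_ zmu _] := Hz i iN; apply: le_trans zmu _.
  apply: ler_sum => j _; apply: ler_sum => k _.
  by rewrite iN ltn_ord.
- move=> j; have [N0|N_gt0] := posnP #|N|.
    by rewrite big_pred0 ?ler0n // => i; apply: (card0_eq N0).
  have -> : (m C j)%:R = \sum_(i in N) (m C j)%:R / #|N|%:R :> R.
    by rewrite sumr_const -[RHS]mulr_natr divfK // pnatr_eq0 -lt0n.
  apply: ler_sum => i iN; have [_ _ zs] := Hz i iN; apply: le_trans (zs j).
  by apply: ler_sum => k _; rewrite iN ltn_ord.
Qed.

Lemma move_down_exists N C x : lp_feasible v mu N C x ->
  exists y, mass_moved_down N C x y.
Proof.
move=> [xb _ _]; pose S i j := \sum_(k < m C j) x i j k.
have x_ge0 i j k : 0 <= x i j k.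
  by have := xb i j k; case: ifP => [_ /andP[]|_ /eqP->].
have x_le1 i j k : x i j k <= 1.
  by have := xb i j k; case: ifP => [_ /andP[]|_ /eqP->].
have S_ge0 i j : 0 <= S i j by exact: sumr_ge0.
have Sl i j l : (l <= m C j)%N -> \sum_(k < l) x i j k <= S i j.
  move=> lm; rewrite (big_ord_widen _ (x i j) lm) /S [leRHS](bigID (fun k : 'I_(m C j) => (k < l)%N)) /=.
  by rewrite lerDl sumr_ge0.
have S1 i j l : \sum_(k < l) x i j k <= l%:R.
  by rewrite -[l in leRHS]card_ord -sumr_const ler_sum.
(* Packing the total [S i j] into the lowest ranks makes the prefix sums [Num.min (S i j) l], the
   largest that entries of at most 1 allow. *)
exists (fun i j k => if (i \in N) && (k < m C j)%N then fill (S i j) k else 0).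
have E i j l : i \in N -> (l <= m C j)%N ->
    \sum_(k < l) (if (i \in N) && (k < m C j)%N then fill (S i j) k else 0)
      = Num.min (S i j) l%:R.
  move=> iN lm; rewrite -sum_fill //; apply: eq_bigr => k _.
  by rewrite iN (leq_trans (ltn_ord k)).
have x0 i j k : i \notin N -> x i j k = 0.
  by move=> /negPf iN; have := xb i j k; rewrite iN => /eqP.
split.
- by move=> i j k; case: (boolP (_ && _)) => //= _; exact: fill_itv.
- move=> i j; have [iN|iN] := boolP (i \in N).
    by have := E i j _ iN (leqnn _); rewrite iN => ->; rewrite min_l // S1.
  by rewrite !big1 // => k _; exact: x0.
- move=> i j l lm; have [iN|iN] := boolP (i \in N).
    by have := E i j l iN lm; rewrite iN /= => ->; rewrite le_min Sl // S1.
  by rewrite !big1 // => k _; exact: x0.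
- move=> i j k l; case: ifP => // _; last by rewrite /fractional ltxx.
  by case: ifP => // _; [exact: fill_fractional|rewrite /fractional ltxx].
Qed.

Lemma move_down_value N C x y : mass_moved_down N C x y ->
  forall i, lp_value v C x i <= lp_value v C y i.
Proof.
move=> [_ _ xy _] i; apply: ler_sum => j _.
apply: sum_mul_le => [k km|k l kl lm|l lm]; last exact: xy.
  by apply: hv.1; exact: leq_trans km (supply_le _ _).
by apply: hv.2 => //; exact: leq_trans lm (supply_le _ _).
Qed.

Lemma move_down_feasible N C x y :
  lp_feasible v mu N C x -> mass_moved_down N C x y -> lp_feasible v mu N C y.
Proof.
move=> [_ xmu xs] xy; have [yb E _ _] := xy; split=> // [i iN|j].
  by apply: le_trans (xmu i iN) (move_down_value xy i).
by under eq_bigr do rewrite E.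
Qed.

End Shares.

(** * Cancelling a cycle *)

Lemma sum_count_fst (I J : finType) (i : I) (s : seq (I * J)) :
  (\sum_j count_mem (i, j) s = count_mem i (unzip1 s))%N.
Proof.
elim: s => [|[a b] s IH] /=; first by rewrite big1.
rewrite big_split /= IH; congr (_ + _)%N.
rewrite (bigD1 b) //= xpair_eqE eqxx andbT big1 ?addn0 // => j.
by rewrite xpair_eqE eq_sym => /negPf->; rewrite andbF.
Qed.

Lemma sum_count_snd (I J : finType) (j : J) (s : seq (I * J)) :
  (\sum_i count_mem (i, j) s = count_mem j (unzip2 s))%N.
Proof.
elim: s => [|[a b] s IH] /=; first by rewrite big1.
rewrite big_split /= IH; congr (_ + _)%N.
rewrite (bigD1 a) //= xpair_eqE eqxx big1 ?addn0 // => i.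
by rewrite xpair_eqE eq_sym => /negPf->.
Qed.

Section Cancelling.

Variables (R : realFieldType) (n t : nat) (K : 'I_t -> nat).
Variables (v : 'I_n -> 'I_t -> nat -> R) (mu : 'I_n -> R).
Variables (N : {set 'I_n}) (C : {set copy K}).
Variables (alpha : 'I_n -> R) (p : 'I_t -> R).

Local Notation m := (supply (K := K)).

Implicit Types x : 'I_n -> 'I_t -> nat -> R.

(* What is left of the optimality of x once the amounts change: by the last
   clause, all fractional goods of an agent have the same value per unit of
   price. *)
Definition tight_solution (x : 'I_n -> 'I_t -> nat -> R) : Prop :=
  [/\ lp_feasible v mu N C x,
      forall i j k l, fractional (x i j k) -> fractional (x i j l) -> k = l,
      forall i, i \in N -> 0 <= alpha i,
      forall j, 0 <= p j
    & forall i j k, fractional (x i j k) -> (1 + alpha i) * v i j k = p j].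

(** Its cardinality is the termination measure of cycle cancelling. *)
Definition frac_set (x : 'I_n -> 'I_t -> nat -> R) : {set 'I_n * copy K} :=
  [set u : 'I_n * copy K | fractional (x u.1 (tag u.2) (tagged u.2))].

Lemma frac_edgeP x i j : bounded N C x -> frac_edge K x i j ->
  exists k, [/\ fractional (x i j k), i \in N & (k < m C j)%N].
Proof.
move=> xb /existsP[k xf]; exists k.
by have [] := fractional_support xb xf.
Qed.

Section Step.

Variables (x : 'I_n -> 'I_t -> nat -> R) (s : seq ('I_n * 'I_t)) (delta : R).
Hypothesis cyc : frac_cycle K x s.
Hypothesis tight : tight_solution x.

Lemma weight_fractional i j k : fractional (x i j k) ->
  weight K x p (i, j) = x i j k * p j.
Proof.
have [[xb _ _] single _ _ _] := tight.
move=> xf; have [_ km] := fractional_support xb xf.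
have kK := leq_trans km (supply_le C j).
rewrite /weight /frac_amount /= (bigD1 (Ordinal kK)) //= big1 ?addr0 // => l.
move=> /andP[xf' /eqP lk]; case: lk; apply/val_inj; exact: single xf' xf.
Qed.

Lemma cycle_edge i j : (i, j) \in s ++ alternate s ->
  exists k, [/\ fractional (x i j k), i \in N & (k < m C j)%N].
Proof.
have [[xb _ _] _ _ _ _] := tight; have /and4P[_ _ _ /allP ec] := cyc.
by move=> /ec; exact: frac_edgeP.
Qed.

Lemma weight_itv u : u \in s ++ alternate s -> 0 <= weight K x p u <= p u.2.
Proof.
case: u => i j /cycle_edge[k [xf _ _]]; rewrite (weight_fractional xf) /=.
have [_ _ _ p_ge0 _] := tight; have := p_ge0 j.
by case/andP: xf; nra.
Qed.

Lemma uniq_cycle : uniq s.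
Proof. by case/and4P: cyc => _ U _ _; exact: map_uniq U. Qed.

Lemma unzip_alternate : unzip1 (alternate s) = rot 1 (unzip1 s) /\
  unzip2 (alternate s) = unzip2 s.
Proof.
rewrite /alternate; have sz : size (rot 1 (unzip1 s)) = size (unzip2 s).
  by rewrite size_rot !size_map.
by rewrite unzip1_zip ?unzip2_zip ?sz.
Qed.

Lemma uniq_alternate : uniq (alternate s).
Proof.
have [_ E] := unzip_alternate; case/and4P: cyc => _ _ U _.
by apply: (@map_uniq _ _ snd); rewrite -/unzip2 E.
Qed.

Hypothesis amount : cancel_amount K x p s delta.

Lemma cancel_amount_bounds :
  [/\ 0 <= delta,
      forall u, u \in s ++ alternate s -> delta <= weight K x p u
    & forall u, u \in alternate s -> delta <= p u.2 - weight K x p u].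
Proof.
have [d0 [/andP[_ /allP d0min] /mapP[u0 u0s d0E] /andP[din /allP dmin]]] := amount.
have dd0 : delta <= d0 by apply: dmin; rewrite mem_head.
split.
- move: din; rewrite inE => /orP[/eqP->|/mapP[u ua ->]].
    by rewrite d0E; have := @weight_itv u0; rewrite mem_cat u0s => /(_ isT)/andP[].
  by have := @weight_itv u; rewrite mem_cat ua orbT subr_ge0 => /(_ isT)/andP[].
- by move=> u us; apply: le_trans dd0 (d0min _ _); exact: map_f.
- by move=> u ua; apply: dmin; rewrite inE; apply/orP; right; apply/mapP; exists u.
Qed.

Local Notation y := (Defs.cancel K x p s delta).

(** With signs, conservation at agents and at goods becomes a count: each agent and each good of the
    cycle lies on one subtracted and one added edge. *)
Definition cycle_sign i j : R :=
  ((i, j) \in alternate s)%:R - ((i, j) \in s)%:R.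

Lemma cycle_sign0 i j : (i, j) \notin s ++ alternate s -> cycle_sign i j = 0.
Proof.
by rewrite mem_cat negb_or /cycle_sign => /andP[/negPf-> /negPf->]; rewrite subrr.
Qed.

Lemma cancel_integral i j k : ~~ fractional (x i j k) -> y i j k = x i j k.
Proof. by rewrite /Defs.cancel => ->. Qed.

Lemma cancel_off i j k : (i, j) \notin s ++ alternate s -> y i j k = x i j k.
Proof.
by rewrite mem_cat negb_or /Defs.cancel => /andP[/negPf-> /negPf->]; rewrite if_same.
Qed.

Lemma cancel_fractional i j k : (i, j) \in s ++ alternate s ->
  fractional (x i j k) ->
  y i j k = if p j == 0 then 0 else x i j k + cycle_sign i j * (delta / p j).
Proof.
move=> ij xf; rewrite /Defs.cancel xf (weight_fractional xf) /cycle_sign /=.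
have := ij; rewrite mem_cat; have [ijs _|ijs /= ija] := boolP ((i, j) \in s).
  rewrite (negPf (alternate_disjoint cyc ijs)).
  case: eqP => [->|/eqP p0]; first by rewrite invr0 mulr0.
  by rewrite sub0r mulN1r mulrBl mulfK.
rewrite ija; case: eqP => [->|/eqP p0]; first by rewrite invr0 mulr0.
by rewrite subr0 mul1r mulrDl mulfK.
Qed.

Lemma cancel_itv i j k : 0 <= x i j k <= 1 -> 0 <= y i j k <= 1.
Proof.
move=> x01; have [xf|xf] := boolP (fractional (x i j k)); last by rewrite cancel_integral.
have [ij|ij] := boolP ((i, j) \in s ++ alternate s); last by rewrite cancel_off.
have [_ _ _ p_ge0 _] := tight; have [d_ge0 dw dp] := cancel_amount_bounds.
rewrite cancel_fractional //; case: eqP => [_|/eqP pj]; first by rewrite lexx ler01.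
have p_gt0 : 0 < p j by rewrite lt_def pj p_ge0.
have dw' := dw _ ij; rewrite (weight_fractional xf) in dw'.
have q_ge0 : 0 <= delta / p j by rewrite divr_ge0.
have qx : delta / p j <= x i j k by rewrite ler_pdivrMr.
move: ij; rewrite /cycle_sign mem_cat.
have [ijs _|ijs /= ija] := boolP ((i, j) \in s).
  by rewrite (negPf (alternate_disjoint cyc ijs)) sub0r mulN1r; move: x01 => /andP[]; lra.
have := dp _ ija; rewrite (weight_fractional xf) /= => dp'.
have q1 : delta / p j <= 1 - x i j k by rewrite ler_pdivrMr // mulrBl mul1r.
by rewrite ija subr0 mul1r; move: x01 => /andP[]; lra.
Qed.

Lemma cancel_fractional_sub i j k : fractional (y i j k) -> fractional (x i j k).
Proof. by apply: contraTT => xf; rewrite cancel_integral. Qed.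

(** Since [(1 + alpha i) * v i j k = p j], changing the amount by [delta / p j] changes the value by
    [delta / (1 + alpha i)], whichever the good. Gains and losses of an agent along the cycle
    therefore cancel. *)
Lemma cancel_good_value i j : i \in N ->
  \sum_(k < m C j) v i j k * y i j k =
  \sum_(k < m C j) v i j k * x i j k + cycle_sign i j * (delta / (1 + alpha i)).
Proof.
move=> iN; have [ij|ij] := boolP ((i, j) \in s ++ alternate s); last first.
  rewrite cycle_sign0 // mul0r addr0; apply: eq_bigr => k _.
  by rewrite cancel_off.
have [k0 [xf _ km]] := cycle_edge ij.
have [_ single a_ge0 p_ge0 cs] := tight; have [d_ge0 dw _] := cancel_amount_bounds.
have a1 : 1 + alpha i != 0 by have := a_ge0 i iN; move=> ?; apply/eqP; lra.
rewrite -(sum_single (Ordinal km) (fun=> cycle_sign i j * (delta / (1 + alpha i)))).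
rewrite -big_split; apply: eq_bigr => k _ /=.
case: eqP => [->|/eqP kk0]; last first.
  rewrite cancel_integral ?addr0 //; apply: contra kk0 => xf'.
  by apply/eqP/val_inj; exact: single xf' xf.
have vE := cs _ _ _ xf.
rewrite /= cancel_fractional //; case: eqP => [pj|/eqP pj].
  have -> : delta = 0.
    apply/eqP; rewrite eq_le d_ge0 andbT; apply: le_trans (dw _ ij) _.
    by rewrite (weight_fractional xf) pj mulr0.
  move/eqP: vE; rewrite pj mulf_eq0 (negPf a1) /= => /eqP->.
  by rewrite !mul0r mulr0 addr0.
rewrite -vE in pj *; have v0 : v i j k0 != 0.
  by apply: contraNneq pj => ->; rewrite mulr0.
by field; rewrite a1 v0.
Qed.

(** Only an inequality: at price 0 the fractional amount is dropped, while [delta / p j] is 0 by the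
    convention on division. *)
Lemma cancel_good_supply i j :
  \sum_(k < m C j) y i j k <=
  \sum_(k < m C j) x i j k + cycle_sign i j * (delta / p j).
Proof.
have [ij|ij] := boolP ((i, j) \in s ++ alternate s); last first.
  rewrite cycle_sign0 // mul0r addr0; apply: ler_sum => k _.
  by rewrite cancel_off.
have [k0 [xf _ km]] := cycle_edge ij; have [_ single _ _ _] := tight.
rewrite -(sum_single (Ordinal km) (fun=> cycle_sign i j * (delta / p j))).
rewrite -big_split; apply: ler_sum => k _ /=.
case: eqP => [->|/eqP kk0]; last first.
  rewrite cancel_integral ?addr0 //; apply: contra kk0 => xf'.
  by apply/eqP/val_inj; exact: single xf' xf.
rewrite /= cancel_fractional //; case: eqP => [->|//].
by rewrite invr0 !mulr0 addr0; case/andP: xf => /ltW.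
Qed.

Lemma natr_mem_uniq (u : 'I_n * 'I_t) r : uniq r -> (u \in r)%:R = (count_mem u r)%:R :> R.
Proof. by move=> U; rewrite count_uniq_mem. Qed.

Lemma sum_cycle_sign_goods i : \sum_j cycle_sign i j = 0.
Proof.
rewrite sumrB; apply/eqP; rewrite subr_eq0; apply/eqP.
under eq_bigr => j _ do rewrite (natr_mem_uniq _ uniq_alternate).
under [RHS]eq_bigr => j _ do rewrite (natr_mem_uniq _ uniq_cycle).
rewrite -!natr_sum !sum_count_fst; have [-> _] := unzip_alternate.
by congr (_%:R); apply/permP; rewrite perm_rot.
Qed.

Lemma sum_cycle_sign_agents j : \sum_(i in N) cycle_sign i j = 0.
Proof.
have -> : \sum_(i in N) cycle_sign i j = \sum_i cycle_sign i j.
  rewrite big_mkcond; apply: eq_bigr => i _; case: ifP => // iN.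
  rewrite cycle_sign0 //; apply/negP => /cycle_edge[k [_ iN' _]].
  by rewrite iN' in iN.
rewrite sumrB; apply/eqP; rewrite subr_eq0; apply/eqP.
under eq_bigr => i _ do rewrite (natr_mem_uniq _ uniq_alternate).
under [RHS]eq_bigr => i _ do rewrite (natr_mem_uniq _ uniq_cycle).
by rewrite -!natr_sum !sum_count_snd; have [_ ->] := unzip_alternate.
Qed.

Lemma cancel_tight : tight_solution y.
Proof.
have [[xb xmu xs] single a_ge0 p_ge0 cs] := tight.
split=> //; last 2 first.
- by move=> i j k l /cancel_fractional_sub xf /cancel_fractional_sub; exact: single.
- by move=> i j k /cancel_fractional_sub; exact: cs.
split.
- move=> i j k; have := xb i j k; case: ifP => _; first exact: cancel_itv.
  move=> /eqP x0; rewrite cancel_integral ?x0 //.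
  by rewrite /fractional ltxx.
- move=> i iN; apply: le_trans (xmu i iN) _.
  rewrite /lp_value; under [leRHS]eq_bigr => j _ do rewrite (cancel_good_value j iN).
  by rewrite big_split /= -mulr_suml sum_cycle_sign_goods mul0r addr0.
- move=> j; apply: le_trans (xs j).
  apply: le_trans (_ : \sum_(i in N) (\sum_(k < m C j) x i j k
    + cycle_sign i j * (delta / p j)) <= _).
    by apply: ler_sum => i _; exact: cancel_good_supply.
  by rewrite big_split /= -mulr_suml sum_cycle_sign_agents mul0r addr0.
Qed.

(* The edge at which delta is attained gets amount 0 or 1. *)
Lemma cancel_decreases : (#|frac_set y| < #|frac_set x|)%N.
Proof.
apply/proper_card/properP; split.
  by apply/subsetP => u; rewrite !inE; exact: cancel_fractional_sub.
suff [i [j [k [xf yf]]]] : exists i j k, fractional (x i j k) /\ ~~ fractional (y i j k).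
  have [[xb _ _] _ _ _ _] := tight.
  have [_ km] := fractional_support xb xf.
  have kK := leq_trans km (supply_le C j).
  by exists (i, Tagged (fun j => 'I_(K j)) (Ordinal kK)); rewrite !inE.
have [d0 [_ /mapP[[i j] ijs ->] /andP[+ _]]] := amount.
rewrite inE => /orP[/eqP dE|/mapP[[i' j'] ija dE]].
  have ij : (i, j) \in s ++ alternate s by rewrite mem_cat ijs.
  have [k [xf _ _]] := cycle_edge ij; exists i, j, k; split=> //.
  rewrite cancel_fractional //; case: eqP => [_|/eqP pj]; first by rewrite /fractional ltxx.
  rewrite /cycle_sign ijs (negPf (alternate_disjoint cyc ijs)) dE.
  rewrite (weight_fractional xf) mulfK // sub0r mulN1r subrr.
  by rewrite /fractional ltxx.
have ij : (i', j') \in s ++ alternate s by rewrite mem_cat ija orbT.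
have [k [xf _ _]] := cycle_edge ij; exists i', j', k; split=> //.
rewrite cancel_fractional //; case: eqP => [_|/eqP pj]; first by rewrite /fractional ltxx.
have ijs' : (i', j') \notin s by apply: contraL ija; exact: alternate_disjoint cyc.
rewrite /cycle_sign ija (negPf ijs') dE (weight_fractional xf) /=.
rewrite subr0 mul1r mulrBl divff // mulfK // addrC subrK.
by rewrite /fractional ltxx andbF.
Qed.

End Step.

Lemma cancel_possible x s : frac_cycle K x s ->
  exists s' delta, frac_cycle K x s' /\ cancel_amount K x p s' delta.
Proof.
move=> cyc; pose W r := [seq weight K x p e | e <- r].
have [d0 d0min] : exists d0, is_min d0 (W (s ++ alternate s)).
  by case/and4P: cyc; case: (s) => //= u r _ _ _ _; exact: exists_min.
have [s' [cyc' d0min' d0in]] : exists s', [/\ frac_cycle K x s',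
    is_min d0 (W (s' ++ alternate s')) & d0 \in W s'].
  have /andP[] := d0min; rewrite {1}/W map_cat mem_cat => /orP[d0s _|d0a d0all].
    by exists s.
  have [s' [cyc' p1 p2]] := frac_cycle_rev cyc; exists s'; split=> //.
    have pp : perm_eq (W (s' ++ alternate s')) (W (s ++ alternate s)).
      by apply: perm_map; rewrite (permPl (perm_cat p1 p2)) perm_catC.
    by rewrite /is_min (perm_mem pp) (perm_all _ pp).
  by rewrite (perm_mem (perm_map _ p1)).
have [delta dmin] := exists_min d0 [seq p e.2 - weight K x p e | e <- alternate s'].
by exists s', delta; split=> //; exists d0.
Qed.

End Cancelling.

(** * Rounding *)

Section Rounding.

Variables (R : realFieldType) (n t : nat) (K : 'I_t -> nat).
Variables (v : 'I_n -> 'I_t -> nat -> R) (mu : 'I_n -> R).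
Variables (N : {set 'I_n}) (C : {set copy K}).
Variables (alpha : 'I_n -> R) (p : 'I_t -> R).
Variables (x : 'I_n -> 'I_t -> nat -> R) (roots : {set 'I_n}).
Hypothesis hv : splc K v.
Hypothesis tight : tight_solution v mu N C alpha p x.
Hypothesis acyclic : forall s, ~~ frac_cycle K x s.
Hypothesis rooted : rooting K N x roots.

Local Notation m := (supply C).
Local Notation ic := (integral_copies K x).
Local Notation e := (frac_edge K x).
Local Notation ch := (child K x roots).

Lemma edge_active i j : e i j -> i \in N.
Proof.
by have [[xb _ _] _ _ _ _] := tight; case/(frac_edgeP xb) => k [].
Qed.

Lemma integral_fractional_bounds i j (k : 'I_(m j)) :
  (x i j k == 1)%:R <= x i j k <= (x i j k == 1)%:R + (fractional (x i j k))%:R.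
Proof.
have [[xb _ _] _ _ _ _] := tight; have := xb i j k; rewrite ltn_ord andbT.
rewrite /fractional; case: ifP => _; last first.
  by move=> /eqP->; rewrite ltxx eq_sym oner_eq0 lexx add0r lexx.
move=> /andP[x_ge0 x_le1]; case: eqP => [->|/eqP x1]; first by rewrite lexx lerDl ler0n.
have [x0|x_gt0] := leP (x i j k) 0.
  by rewrite x_ge0 add0r; apply: le_trans x0 (ler0n _ _).
by rewrite x_ge0 lt_neqAle x1 x_le1 add0r /= x_le1.
Qed.

Lemma integral_copiesE i j : (ic i j)%:R = \sum_(k < m j) (x i j k == 1)%:R :> R.
Proof.
have [[xb _ _] _ _ _ _] := tight.
rewrite -natr_sum; congr (_%:R).
rewrite (big_ord_widen (K j) (fun k => (x i j k == 1) : nat) (supply_le C j)).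
rewrite /integral_copies -sum1dep_card [LHS]big_mkcond [RHS]big_mkcond /=.
apply: eq_bigr => k _; case: ltnP => km; first by case: eqP.
by have := xb i j k; rewrite ltnNge km andbF => /eqP->; rewrite eq_sym oner_eq0.
Qed.

Lemma sum_fractional i j : \sum_(k < m j) (fractional (x i j k))%:R = (e i j)%:R :> R.
Proof.
have [[xb _ _] single _ _ _] := tight.
case: (boolP (e i j)) => [eij|/existsPn ne].
  have [k0 [xf _ km]] := frac_edgeP xb eij.
  rewrite -[RHS](sum_single (Ordinal km) (fun=> 1)); apply: eq_bigr => k _.
  case: eqP => [->|/eqP kk0]; first by rewrite xf.
  apply/eqP; rewrite pnatr_eq0 eqb0; apply: contra kk0 => xf'.
  by apply/eqP/val_inj; exact: single xf' xf.
rewrite big1 // => k _; have := ne (Ordinal (leq_trans (ltn_ord k) (supply_le C j))).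
by move=> /= /negPf->.
Qed.

Lemma amount_le i j : \sum_(k < m j) x i j k <= (ic i j + e i j)%:R.
Proof.
rewrite natrD integral_copiesE -sum_fractional -big_split.
by apply: ler_sum => k _; case/andP: (integral_fractional_bounds i k).
Qed.

Lemma amount_ge i j : (ic i j)%:R <= \sum_(k < m j) x i j k.
Proof.
by rewrite integral_copiesE; apply: ler_sum => k _; case/andP: (integral_fractional_bounds i k).
Qed.

Lemma amount_gt i j : e i j -> (ic i j)%:R < \sum_(k < m j) x i j k.
Proof.
have [[xb _ _] single _ _ _] := tight.
move=> /(frac_edgeP xb)[k0 [xf _ km]]; rewrite integral_copiesE.
rewrite (bigD1 (Ordinal km)) //= [ltRHS](bigD1 (Ordinal km)) //=.
apply: ltr_leD; last by apply: ler_sum => k _; case/andP: (integral_fractional_bounds i k).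
by case/andP: xf => x0 x1; rewrite (lt_eqF x1).
Qed.

Lemma copies_le_supply i j : (ic i j + e i j <= m j)%N.
Proof.
rewrite -(ler_nat R) natrD integral_copiesE -sum_fractional -big_split.
rewrite -[m j in leRHS]card_ord -sumr_const; apply: ler_sum => k _ /=.
by rewrite /fractional; case: eqP => [->|_]; rewrite ?ltxx ?andbF ?addr0 // add0r lern1 leq_b1.
Qed.

Lemma rounded_exists A : exists A', rounded N C A x roots A'.
Proof.
have [[xb xmu xs] _ _ _ _] := tight.
have sum_le j : (\sum_(i in N) (ic i j + ch i j) <= #|C :&: copies_of K j|)%N.
  rewrite -/(supply C j) big_split /=.
  have ic_le : (\sum_(i in N) ic i j <= m j)%N.
    rewrite -(ler_nat R) natr_sum; apply: le_trans (xs j).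
    by apply: ler_sum => i _; exact: amount_ge.
  case: (pickP (fun i => ch i j)) => [i0 ci0|no]; last first.
    by rewrite [X in (_ + X)%N]big1 ?addn0 // => i _; rewrite no.
  have ei0 : e i0 j by case/andP: ci0.
  have i0N := edge_active ei0.
  rewrite [X in (_ + X)%N](bigD1 i0) //= ci0 [X in (_ + (_ + X))%N]big1 => [|i /andP[_ ii0]]; last first.
    case: (boolP (ch i j)) => // ci; move: ii0.
    by rewrite (child_unique_parent acyclic rooted ci ci0) eqxx.
  (* The parent holds a positive fraction of [j] on top of the whole copies, so these number
     strictly less than the supply; by integrality there is room for one more. *)
  rewrite addn0 addn1 -(ltr_nat R) natr_sum; apply: lt_le_trans (xs j).
  rewrite (bigD1 i0) //= [ltRHS](bigD1 i0) //=.
  by apply: ltr_leD; [exact: amount_gt|apply: ler_sum => i _; exact: amount_ge].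
have [F HF] := fin_all_exists (fun j => disjoint_subsets (sum_le j)).
pose U i := \bigcup_j F j i.
have UC i : U i \subset C.
  by apply/bigcupsP => j _; have [FS _ _] := HF j; apply: subset_trans (FS i) (subsetIl _ _).
have UI i j : U i :&: copies_of K j = F j i.
  apply/setP => c; rewrite inE; apply/andP/idP => [[/bigcupP[j' _ cF] cj]|cF].
    have [FS _ _] := HF j'; have := subsetP (FS i) _ cF; rewrite !inE => /andP[_ /eqP cj'].
    by move: cj; rewrite inE cj' => /eqP <-.
  have [FS _ _] := HF j; have := subsetP (FS i) _ cF; rewrite inE => /andP[_ ->].
  by split=> //; apply/bigcupP; exists j.
exists [ffun i => if i \in N then U i else A i]; split.
- by move=> i iN; rewrite ffunE (negPf iN).
- by move=> i iN; rewrite ffunE iN.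
- move=> i i' iN i'N ii'; rewrite !ffunE iN i'N -setI_eq0.
  apply/eqP/setP => c; rewrite !inE; apply/negP => /andP[cU cU'].
  have [_ Fd _] := HF (tag c); have := Fd i i' iN i'N ii'.
  by rewrite -!UI => /disjoint_setI0/setP/(_ c); rewrite !inE cU cU' eqxx.
- by move=> i j iN; rewrite ffunE iN UI; have [_ _ ->] := HF j.
Qed.

Hypothesis mu_ge0 : forall i, 0 <= mu i.
Hypothesis small : forall i c, ~~ reducible v mu N C i c.

(** A fractional entry has a rank below the supply, so some copy of [j] is still active and the
    reduction test has failed for it. *)
Lemma edge_value_lt i j : e i j -> v i j 0%N < mu i / 2.
Proof.
have [[xb _ _] _ _ _ _] := tight.
move=> /(frac_edgeP xb)[k [_ iN km]].
have /card_gt0P[c] : (0 < #|C :&: copies_of K j|)%N by exact: leq_ltn_trans km.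
rewrite !inE => /andP[cC /eqP cj].
by have := small i c; rewrite /reducible iN cC cj /= -ltNge.
Qed.

Lemma rounded_value A A' i : rounded N C A x roots A' -> i \in N ->
  mu i / 2 <= value v i (A' i).
Proof.
move=> [_ _ _ cnt] iN; have [[xb xmu xs] _ _ _ _] := tight.
(* The fractional copy has some later rank, but its value is bounded by that of rank 0, the one
   compared with [mu i / 2] in the reduction test. A child good is rounded up and loses nothing. *)
pose lost j := if e i j && ~~ ch i j then v i j 0%N else 0.
have good j : \sum_(k < m j) v i j k * x i j k <=
    \sum_(k < #|A' i :&: copies_of K j|) v i j k + lost j.
  rewrite cnt //; apply: le_trans (_ : \sum_(k < ic i j + e i j) v i j k <= _).
    apply: sum_mul_le_prefix.
    - by move=> k km; apply: hv.1; exact: leq_trans km (supply_le C j).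
    - by move=> k l kl lm; apply: hv.2 => //; exact: leq_trans lm (supply_le C j).
    - by move=> k km; have := xb i j k; rewrite iN km.
    - exact: copies_le_supply.
    - exact: amount_le.
  rewrite /lost; have := copies_le_supply i j; have : ch i j -> e i j by case/andP.
  case: (ch i j) => [->//|_ ]; rewrite ?addr0 //=.
  case: (e i j) => /=; rewrite ?addr0 // addn0 addn1 big_ord_recr /= lerD2l => icm.
  by apply: hv.2 => //; exact: leq_trans icm (supply_le C j).
have lost_le : \sum_j lost j <= mu i / 2.
  case: (pickP (fun j => e i j && ~~ ch i j)) => [j0 j0P|no]; last first.
    by rewrite big1 ?divr_ge0 // => j _; rewrite /lost no.
  have /andP[ej0 cj0] := j0P.
  rewrite (bigD1 j0) //= big1 ?addr0 => [|j jj0]; last first.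
    rewrite /lost; case: ifP => // /andP[ej cj]; move: jj0.
    by rewrite (nonchild_unique acyclic edge_active rooted ej ej0 cj cj0) eqxx.
  by rewrite /lost j0P ltW // edge_value_lt.
have : lp_value v C x i <= value v i (A' i) + \sum_j lost j.
  by rewrite -big_split; apply: ler_sum => j _; exact: good.
by have := xmu i iN; lra.
Qed.

End Rounding.

(** * Total correctness *)

Section Algorithm.

Variables (R : realFieldType) (n t : nat) (K : 'I_t -> nat).
Variables (v : 'I_n -> 'I_t -> nat -> R) (mu : 'I_n -> R).
Hypothesis hv : splc K v.
Hypothesis mu_ge0 : forall i, 0 <= mu i.

Implicit Types (N : {set 'I_n}) (C : {set copy K}) (A : {ffun 'I_n -> {set copy K}}).

Definition half_shares (s : state R n K) : Prop :=
  exists A, s = Returned R A /\ forall i, mu i / 2 <= value v i (A i).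

Definition served N A : Prop :=
  forall i, i \notin N -> mu i / 2 <= value v i (A i).

Lemma optimal_solutions N C : shared v mu N C ->
  exists x p, lp_optimal v mu N C x /\ optimal_supply_dual v mu N C p.
Proof.
move=> /shared_feasible /(program_duality hv)[x [alpha [p [q [fx dq gap]]]]].
exists x, p; split; first by split=> // y fy; exact: le_trans (weak_duality dq fy) gap.
exists alpha, q; split=> // alpha' p' q' dq'.
exact: le_trans gap (weak_duality dq' fx).
Qed.

(** Moving mass down does not lower the objective, so [y] is at least as good as the optimum [x].
    Comparing [x] and the given prices with the pair from [program_duality] shows that [y] has no
    gap to the dual solution behind [p], which supplies [alpha]. *)
Lemma move_down_tight N C x p y :
  lp_optimal v mu N C x -> optimal_supply_dual v mu N C p ->
  mass_moved_down N C x y -> exists alpha, tight_solution v mu N C alpha p y.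
Proof.
move=> [fx xmax] [alpha [q [dq dmin]]] xy; exists alpha.
have fy := move_down_feasible hv fx xy.
have [_ _ _ single] := xy; have [a_ge0 p_ge0 _ _] := dq.
split=> //; apply: (complementary_slackness dq fy).
have [x0 [alpha0 [p0 [q0 [fx0 dq0 gap]]]]] := program_duality hv (ex_intro _ x fx).
apply: le_trans (dmin _ _ _ dq0) _; apply: le_trans gap _.
apply: le_trans (xmax _ fx0) _; apply: ler_sum => i _.
exact: (move_down_value hv xy).
Qed.

Lemma cancelling_reaches N C A alpha p x :
  (forall i c, ~~ reducible v mu N C i c) -> served N A ->
  tight_solution v mu N C alpha p x ->
  always_reaches (step v mu) half_shares (Cancelling N C A x p).
Proof.
move=> small sA; have [k] := ubnP #|frac_set K x|; elim: k x => // k IH x xk tight.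
apply: Progress.
  case: (frac_cycleP K x) => [[s cyc]|acyclic].
    have [s' [delta [cyc' am]]] := cancel_possible p cyc.
    by eexists; exact: Cancel cyc' am.
  have [roots rooted] := rooting_exists K x N.
  have [A' rA] := rounded_exists tight acyclic rooted A.
  by eexists; exact: Round acyclic rooted rA.
move=> s' st; inversion st as [| | |? ? ? ? ? ? ? cyc am|? ? ? ? ? ? A' ? rooted rA]; subst.
  apply: IH; last exact: cancel_tight.
  by rewrite ltnS in xk; apply: leq_trans xk; exact: (cancel_decreases cyc tight am).
apply: Reached; exists A'; split=> // i; have [iN|iN] := boolP (i \in N).
  by apply: (rounded_value hv tight _ rooted mu_ge0 small rA).
by case: rA => -> // _ _ _; exact: sA.
Qed.

Lemma solved_reaches N C A x p :
  (forall i c, ~~ reducible v mu N C i c) -> served N A ->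
  lp_optimal v mu N C x -> optimal_supply_dual v mu N C p ->
  always_reaches (step v mu) half_shares (Solved N C A x p).
Proof.
move=> small sA xopt popt; apply: Progress.
  have [y xy] := move_down_exists xopt.1.
  by eexists; exact: MoveDown xy.
move=> s' st; inversion st as [| |? ? ? ? ? ? xy| |]; subst.
have [alpha tight] := move_down_tight xopt popt xy.
exact: cancelling_reaches tight.
Qed.

Lemma reducing_reaches N C A : shared v mu N C -> served N A ->
  always_reaches (step v mu) half_shares (Reducing R N C A).
Proof.
have [k] := ubnP #|N|; elim: k N C A => // k IH N C A Nk sh sA.
apply: Progress.
  case: (boolP [exists i, exists c, reducible v mu N C i c]).
    by move=> /existsP[i /existsP[c ic]]; eexists; exact: Reduce ic.
  move=> none; have [x [p [xopt popt]]] := optimal_solutions sh.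
  eexists; apply: Solve xopt popt => i c; apply: contra none => ic.
  by apply/existsP; exists i; apply/existsP; exists c.
move=> s' st; inversion st as [? ? ? i c red| | | |]; subst; last exact: solved_reaches.
have /and3P[iN cC ic] := red.
apply: IH; first by move: Nk; rewrite (cardsD1 i N) iN.
  exact: shared_reduce.
move=> i'; rewrite !inE negb_and negbK ffunE; case: eqP => [->|_] /=; last exact: sA.
by rewrite value1.
Qed.

End Algorithm.

Lemma shared_initial (R : realFieldType) (n t : nat) (K : 'I_t -> nat)
    (v : 'I_n -> 'I_t -> nat -> R) :
  splc K v -> shared v (mms K v) setT [set: copy K].
Proof.
move=> hv i _; have [B HB] := mms_attained hv i.
by exists setT, B; split=> // k _; rewrite setTI.
Qed.

Theorem theorem4p1 (R : realFieldType) (n t : nat) (K : 'I_t -> nat)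
    (v : 'I_n -> 'I_t -> nat -> R) (hv : splc K v) :
  always_reaches (step v (mms K v))
    (fun s => exists A : {ffun 'I_n -> {set copy K}},
       s = Returned R A /\ forall i : 'I_n, mms K v i / 2 <= value v i (A i))
    (initial R n K).
Proof.
apply: (reducing_reaches (mu := mms K v) hv) => [i||]; first exact: mms_ge0.
  exact: shared_initial.
by move=> i; rewrite inE.
Qed.
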